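(* Let $M$ be a vector space over $k$ of dimension $n\ge1$ and let $A$ be an index set. Suppose $M$ is decomposed as a direct sum of nonzero subspaces $\bigoplus_{\alpha\in A}M_\alpha$; set $\chi_i=|\{\alpha\in A\mid\dim(M_\alpha)=i\}|$ and $\chi_{3+}=\sum_{i=3}^n\chi_i$. Let $\mathsf{u}\in\mathcal{W}_k$ and let $n_\circ=\dim(\mathsf{u})$ denote its anisotropic dimension. If $n-n_\circ$ is a nonnegative even integer, then the number $\mathsf{T}(\mathsf{u})_{\chi_1,\chi_2,\chi_{3+}}$ of ways, up to isometry on each subspace, of assigning a nondegenerate quadratic form to each of the $|A|$ subspaces $M_\alpha$ such that the sum is equivalent to $\mathsf{u}$ in the Witt group is $$\mathsf{T}(\mathsf{u})_{\chi_1,\chi_2,\chi_{3+}}=\begin{cases}\frac18\,4^{\chi_1}7^{\chi_2}8^{\chi_{3+}} & \text{if }\chi_{3+}\ge1;\\[2pt] \frac18\,4^{\chi_1}7^{\chi_2}+(2-n_\circ)2^{\chi_1-2} & \text{if }\chi_{3+}=0,\ \chi_1\ge1;\\[2pt] \left\lfloor\frac18 7^{\chi_2}\right\rceil+\varepsilon_{n_\circ,\chi_2} & \text{if }\chi_1=\chi_{3+}=0,\end{cases}$$ where $\varepsilon_{n_\circ,\chi_2}=(-1)^{\chi_2}$ if $n_\circ=0$ and $\chi_2$ is even, or $n_\circ=4$ and $\chi_2$ is odd, and $\varepsilon_{n_\circ,\chi_2}=0$ otherwise.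
   Context: $k$ is a local non-archimedean field of residual characteristic $p\ne2$, and $\mathcal{W}_k$ is the Witt group of nondegenerate quadratic forms over $k$ modulo hyperbolic planes. The anisotropic dimension of a Witt class is the dimension of its anisotropic representative. $\lfloor x\rceil$ denotes the integer closest to $x$. *)

(* Defs.v *)
From HB Require Import structures.
From mathcomp Require Import all_boot all_order all_algebra.
From mathcomp Require Import all_classical all_reals.
From mathcomp Require Import ring.

Set Implicit Arguments.
Unset Strict Implicit.
Unset Printing Implicit Defensive.

Import Order.TTheory GRing.Theory Num.Theory.
Import VectorInternalTheory.

Local Open Scope ring_scope.

(** A field complete for a normalized discrete valuation (of either
    characteristic), with finite residue field.  The residue field is given,
    up to unique isomorphism, by a map [lf_res] which on the valuation ring
    [0 <= v x] is a surjective ring morphism with kernel [0 < v x]; the values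
    of [lf_res] outside the valuation ring are irrelevant. *)
Record local_field (k : fieldType) := LocalField {
  lf_val : k -> \bar int;
  lf_val_ninfty : forall x, lf_val x != -oo%E;
  lf_val_pinfty : forall x, (lf_val x == +oo%E) = (x == 0);
  lf_valM : forall x y, lf_val (x * y) = (lf_val x + lf_val y)%E;
  lf_valD : forall x y,
    (Order.min (lf_val x) (lf_val y) <= lf_val (x + y)%R)%E;
  lf_val_norm : exists x, lf_val x = 1%:E%E;
  lf_complete : forall s : nat -> k,
    (forall N : int, exists n0, forall m n, (n0 <= m)%N -> (n0 <= n)%N ->
       (N%:E <= lf_val (s m - s n)%R)%E) ->
    exists l, forall N : int, exists n0, forall n, (n0 <= n)%N ->
       (N%:E <= lf_val (s n - l)%R)%E;
  lf_resfield : finFieldType;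
  lf_res : k -> lf_resfield;
  lf_res1 : lf_res 1 = 1;
  lf_resD : forall x y, (0 <= lf_val x)%E -> (0 <= lf_val y)%E ->
    lf_res (x + y) = lf_res x + lf_res y;
  lf_resM : forall x y, (0 <= lf_val x)%E -> (0 <= lf_val y)%E ->
    lf_res (x * y) = lf_res x * lf_res y;
  lf_res_surj : forall c, exists2 x, (0 <= lf_val x)%E & lf_res x = c;
  lf_res_ker : forall x, (0 <= lf_val x)%E ->
    (lf_res x == 0) = (0 < lf_val x)%E
}.

Definition polar (k : fieldType) (V : vectType k) (q : V -> k) (x y : V) : k :=
  q (x + y) - q x - q y.

(** One-sided linearity of [polar q] suffices: it is symmetric. *)
Definition quadratic (k : fieldType) (V : vectType k) (q : V -> k) : Prop :=
  (forall a x, q (a *: x) = a ^+ 2 * q x) /\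
  (forall y, scalar (polar q ^~ y)).

Definition nondegenerate (k : fieldType) (V : vectType k) (q : V -> k) : Prop :=
  forall x, (forall y, polar q x y = 0) -> x = 0.

Record qform (k : fieldType) (V : vectType k) := QForm {
  qf :> V -> k;
  qf_quadratic : quadratic qf;
  qf_nondegenerate : nondegenerate qf
}.

Definition isometric (k : fieldType) (V W : vectType k)
    (q : qform V) (r : qform W) : Prop :=
  exists f : V -> W, [/\ linear f, bijective f & forall x, r (f x) = q x].

Definition anisotropic (k : fieldType) (V : vectType k) (q : qform V) : Prop :=
  forall x, q x = 0 -> x = 0.

Section QuadraticForms.
Variable k : fieldType.
Implicit Types V W U : vectType k.

Lemma polarC V (q : V -> k) x y : polar q x y = polar q y x.
Proof. by rewrite /polar (addrC y x); ring. Qed.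

Lemma quadratic0 V (q : V -> k) : quadratic q -> q 0 = 0.
Proof. by case=> qZ _; rewrite -(scale0r 0) qZ expr0n mul0r. Qed.

Lemma quadraticD V (q : V -> k) x y : q (x + y) = q x + q y + polar q x y.
Proof. by rewrite /polar; ring. Qed.

Lemma polarDl V (q : V -> k) x y z : quadratic q ->
  polar q (x + y) z = polar q x z + polar q y z.
Proof. by case=> _ /(_ z 1 x y) /=; rewrite scale1r mul1r. Qed.

Lemma polar0l V (q : V -> k) z : quadratic q -> polar q 0 z = 0.
Proof.
move=> hq; have := polarDl 0 0 z hq; rewrite addr0 => /eqP.
by rewrite -subr_eq subrr eq_sym => /eqP.
Qed.

Lemma polarZl V (q : V -> k) a x z : quadratic q ->
  polar q (a *: x) z = a * polar q x z.
Proof.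
by move=> hq; case: (hq) => _ /(_ z a x 0) /=; rewrite addr0 polar0l // addr0.
Qed.

Lemma linear_fun0 V W (f : V -> W) : linear f -> f 0 = 0.
Proof.
by move=> fl; move: (fl (-1) 0 0); rewrite scaler0 addr0 scaleN1r addNr.
Qed.

Lemma linear_funD V W (f : V -> W) x y : linear f -> f (x + y) = f x + f y.
Proof. by move=> fl; move: (fl 1 x y); rewrite !scale1r. Qed.

Lemma linear_funZ V W (f : V -> W) a x : linear f -> f (a *: x) = a *: f x.
Proof. by move=> fl; move: (fl a x 0); rewrite (linear_fun0 fl) !addr0. Qed.

Lemma linear_can V W (f : V -> W) g : linear f -> cancel f g -> cancel g f ->
  linear g.
Proof.
move=> fl fK gK a x y; apply: (can_inj fK).
by rewrite gK fl !gK.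
Qed.

Lemma linear_bij V W (f : V -> W) : linear f -> injective f ->
  \dim {:V} = \dim {:W} -> bijective f.
Proof.
move=> fl fi dVW.
pose fL : {linear V -> W} := HB.pack f (GRing.isLinear.Build k V W *:%R f fl).
pose h : 'Hom(V, W) := linfun fL.
have hE x : h x = f x by rewrite lfunE.
have h0 : lker h == 0%VS by apply/lker0P=> x y; rewrite !hE; apply: fi.
have hT : limg h = fullv.
  by apply/eqP; rewrite eqEdim subvf limg_dim_eq //= ?dVW // (eqP h0) capv0.
exists (h^-1)%VF => x; first by rewrite -hE lker0_lfunK.
by rewrite -hE limg_lfunVK // hT memvf.
Qed.

Lemma isometric_refl V (q : qform V) : isometric q q.
Proof. by exists id; split=> //; exists id. Qed.

Lemma isometric_sym V W (q : qform V) (r : qform W) :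
  isometric q r -> isometric r q.
Proof.
case=> f [fl [g fK gK] fq]; exists g; split; first exact: (linear_can fl).
  by exists f.
by move=> x; rewrite -fq gK.
Qed.

Lemma isometric_trans V W U (r : qform W) (q : qform V) (s : qform U) :
  isometric q r -> isometric r s -> isometric q s.
Proof.
case=> f [fl fb fq] [g [gl gb gr]]; exists (g \o f); split.
- by move=> a x y /=; rewrite fl gl.
- exact: bij_comp.
- by move=> x /=; rewrite gr fq.
Qed.

Section Pullback.
Variables (V W : vectType k) (f : V -> W) (q : qform W).
Hypotheses (fl : linear f) (fb : bijective f).

Lemma pullback_polar x y : polar (q \o f) x y = polar q (f x) (f y).
Proof. by rewrite /polar /= linear_funD. Qed.

Lemma pullback_quadratic : quadratic (q \o f).
Proof.
have hq := qf_quadratic q; split=> [a x|y a x z] /=.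
  by rewrite linear_funZ // hq.1.
by rewrite !pullback_polar fl polarDl // polarZl.
Qed.

Lemma pullback_nondegenerate : nondegenerate (q \o f).
Proof.
move=> x hx; apply: (bij_inj fb); rewrite linear_fun0 //.
apply: (qf_nondegenerate (q := q)) => y.
by case: fb => g fK gK; rewrite -(gK y) -pullback_polar.
Qed.

Definition pullback : qform V := QForm pullback_quadratic pullback_nondegenerate.

Lemma pullback_isometric : isometric pullback q.
Proof. by exists f. Qed.

End Pullback.

Lemma r2v_linear V : linear (r2v : 'rV[k]_(dim V) -> V).
Proof. by move=> a x y; rewrite linearP. Qed.

Lemma r2v_bij V : bijective (r2v : 'rV[k]_(dim V) -> V).
Proof. by exists (v2r : V -> _); [exact: (@r2vK k V) | exact: (@v2rK k V)]. Qed.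

Definition coord_form V (q : qform V) : qform 'rV[k]_(dim V) :=
  pullback q (@r2v_linear V) (@r2v_bij V).

Section OrthogonalSum.
Variables (V W : vectType k) (q : qform V) (r : qform W).

Definition osum_fun (x : V * W) : k := q x.1 + r x.2.

Lemma osum_polar x y :
  polar osum_fun x y = polar q x.1 y.1 + polar r x.2 y.2.
Proof. by rewrite /polar /osum_fun /=; ring. Qed.

Lemma osum_quadratic : quadratic osum_fun.
Proof.
have hq := qf_quadratic q; have hr := qf_quadratic r.
split=> [a x|y a x z] /=; first by rewrite /osum_fun /= hq.1 hr.1 mulrDr.
by rewrite !osum_polar /= !polarDl // !polarZl //; ring.
Qed.

Lemma osum_nondegenerate : nondegenerate osum_fun.
Proof.
case=> x x' hx; congr pair.
- apply: (qf_nondegenerate (q := q)) => y.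
  have := hx (y, 0); rewrite osum_polar /= polarC.
  by rewrite [polar r _ _]polarC (polar0l _ (qf_quadratic r)) addr0 polarC.
- apply: (qf_nondegenerate (q := r)) => y.
  have := hx (0, y); rewrite osum_polar /=.
  by rewrite [polar q _ _]polarC (polar0l _ (qf_quadratic q)) add0r.
Qed.

Definition osum : qform (V * W)%type := QForm osum_quadratic osum_nondegenerate.

End OrthogonalSum.

Lemma osumC V W (q : qform V) (r : qform W) :
  isometric (osum q r) (osum r q).
Proof.
exists (fun x => (x.2, x.1)); split=> //; last first.
  by move=> x; rewrite /= /osum_fun addrC.
by exists (fun x => (x.2, x.1)) => -[].
Qed.

Lemma osumA V W U (q : qform V) (r : qform W) (s : qform U) :
  isometric (osum q (osum r s)) (osum (osum q r) s).
Proof.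
exists (fun x => ((x.1, x.2.1), x.2.2)); split=> //; last first.
  by move=> x; rewrite /= /osum_fun /= /osum_fun addrA.
by exists (fun x => (x.1.1, (x.1.2, x.2))) => [[? []]|[[]]].
Qed.

Lemma isometric_osum V V' W W' (q : qform V) (q' : qform V') (r : qform W)
    (r' : qform W') : isometric q q' -> isometric r r' ->
  isometric (osum q r) (osum q' r').
Proof.
case=> f [fl [f' fK f'K] fq] [g [gl [g' gK g'K] gr]].
exists (fun x => (f x.1, g x.2)); split.
- by move=> a x y /=; rewrite fl gl.
- by exists (fun x => (f' x.1, g' x.2)) => -[x y] /=; rewrite ?fK ?gK ?f'K ?g'K.
- by move=> x; rewrite /= /osum_fun fq gr.
Qed.

Section Hyperbolic.
Variable m : nat.

(** The orthogonal sum of [m] hyperbolic planes; the plane number [i] is the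
    [i]-th row, with coordinates [A i 0] and [A i 1]. *)
Definition hyp_fun (A : 'M[k]_(m, 2)) : k := \sum_i A i 0 * A i 1.

Lemma hyp_polar A B :
  polar hyp_fun A B = \sum_i (A i 0 * B i 1 + A i 1 * B i 0).
Proof.
rewrite /polar /hyp_fun -!sumrB; apply: eq_bigr => i _; rewrite !mxE; ring.
Qed.

Lemma hyp_quadratic : quadratic hyp_fun.
Proof.
split=> [a x|y a x z] /=.
  by rewrite /hyp_fun mulr_sumr; apply: eq_bigr => i _; rewrite !mxE; ring.
rewrite !hyp_polar mulr_sumr -big_split; apply: eq_bigr => i _ /=.
by rewrite !mxE; ring.
Qed.

Lemma hyp_nondegenerate : nondegenerate hyp_fun.
Proof.
move=> A hA; apply/matrixP=> i j; rewrite mxE.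
have := hA (delta_mx i (1 - j)); rewrite hyp_polar (bigD1 i) //= big1 => [|i' ii'].
  rewrite !mxE eqxx /= addr0.
  have [->|->] : j = 0 \/ j = 1.
  - by case: j => [[|[|//]] ?]; [left|right]; apply/val_inj.
  - by rewrite subr0 /= mulr1 mulr0 addr0.
  - by rewrite subrr /= mulr1 mulr0 add0r.
by rewrite !mxE (negPf ii') /= !mulr0 addr0.
Qed.

Definition hyperbolic : qform 'M[k]_(m, 2) :=
  QForm hyp_quadratic hyp_nondegenerate.

End Hyperbolic.

Lemma hyperbolicD m n :
  isometric (osum (hyperbolic m) (hyperbolic n)) (hyperbolic (m + n)).
Proof.
exists (fun x => col_mx x.1 x.2); split.
- by move=> a x y /=; rewrite scale_col_mx add_col_mx.
- exists (fun A => (usubmx A, dsubmx A)) => [[A B]|A] /=.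
    by rewrite col_mxKu col_mxKd.
  by rewrite vsubmxK.
- move=> [A B]; rewrite /= /osum_fun /= /hyp_fun big_split_ord /=.
  by congr (_ + _); apply: eq_bigr => i _; rewrite ?col_mxEu ?col_mxEd.
Qed.

Lemma osum_hyperbolic0 V (q : qform V) : isometric (osum q (hyperbolic 0)) q.
Proof.
exists fst; split=> //; last first.
  by move=> [x A]; rewrite /= /osum_fun /= /hyp_fun big_ord0 addr0.
exists (fun x => (x, 0)) => //= -[x A] /=; congr pair.
by apply/matrixP=> -[].
Qed.

Definition witt_equiv V W (q : qform V) (r : qform W) : Prop :=
  exists m n, isometric (osum q (hyperbolic m)) (osum r (hyperbolic n)).

Lemma isometric_witt V W (q : qform V) (r : qform W) :
  isometric q r -> witt_equiv q r.
Proof.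
by move=> h; exists 0%N, 0%N; apply: isometric_osum h (isometric_refl _).
Qed.

Lemma witt_refl V (q : qform V) : witt_equiv q q.
Proof. exact: isometric_witt (isometric_refl q). Qed.

Lemma witt_sym V W (q : qform V) (r : qform W) :
  witt_equiv q r -> witt_equiv r q.
Proof. by case=> m [n h]; exists n, m; apply: isometric_sym. Qed.

Lemma osum_hypD V (q : qform V) m n :
  isometric (osum (osum q (hyperbolic m)) (hyperbolic n))
            (osum q (hyperbolic (m + n))).
Proof.
apply: isometric_trans (isometric_sym (osumA _ _ _)) _.
exact: isometric_osum (isometric_refl q) (hyperbolicD m n).
Qed.

Lemma osumCA V W U (q : qform V) (r : qform W) (s : qform U) :
  isometric (osum (osum q r) s) (osum (osum q s) r).
Proof.
apply: isometric_trans (isometric_sym (osumA _ _ _)) _.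
apply: isometric_trans _ (osumA _ _ _).
exact: isometric_osum (isometric_refl q) (osumC _ _).
Qed.

Lemma witt_trans V W U (r : qform W) (q : qform V) (s : qform U) :
  witt_equiv q r -> witt_equiv r s -> witt_equiv q s.
Proof.
case=> m [n h] [m' [n' h']]; exists (m + m')%N, (n' + n)%N.
apply: isometric_trans (isometric_sym (osum_hypD _ _ _)) _.
apply: isometric_trans _ (osum_hypD _ _ _).
apply: isometric_trans (isometric_osum h (isometric_refl _)) _.
apply: isometric_trans (osumCA _ _ _) _.
exact: isometric_osum h' (isometric_refl _).
Qed.

Lemma witt_osuml V W U (q : qform V) (r : qform W) (s : qform U) :
  witt_equiv q r -> witt_equiv (osum q s) (osum r s).
Proof.
case=> m [n h]; exists m, n.
apply: isometric_trans (osumCA _ _ _) _.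
apply: isometric_trans (isometric_osum h (isometric_refl _)) _.
exact: osumCA.
Qed.

Lemma witt_osum V V' W W' (q : qform V) (q' : qform V') (r : qform W)
    (r' : qform W') : witt_equiv q q' -> witt_equiv r r' ->
  witt_equiv (osum q r) (osum q' r').
Proof.
move=> hq hr; apply: witt_trans (witt_osuml r hq) _.
apply: witt_trans (isometric_witt (osumC _ _)) _.
apply: witt_trans _ (isometric_witt (osumC _ _)).
exact: witt_osuml.
Qed.

Section Opposite.
Variables (V : vectType k) (q : qform V).

Definition oppq_fun (x : V) : k := - q x.

Lemma oppq_polar x y : polar oppq_fun x y = - polar q x y.
Proof. by rewrite /polar /oppq_fun; ring. Qed.

Lemma oppq_quadratic : quadratic oppq_fun.
Proof.
have hq := qf_quadratic q; split=> [a x|y a x z] /=.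
  by rewrite /oppq_fun hq.1; ring.
by rewrite !oppq_polar polarDl // polarZl //; ring.
Qed.

Lemma oppq_nondegenerate : nondegenerate oppq_fun.
Proof.
move=> x hx; apply: (qf_nondegenerate (q := q)) => y.
by apply: oppr_inj; rewrite -oppq_polar hx oppr0.
Qed.

Definition oppq : qform V := QForm oppq_quadratic oppq_nondegenerate.

End Opposite.

Lemma isometric_oppq V W (q : qform V) (r : qform W) :
  isometric q r -> isometric (oppq q) (oppq r).
Proof.
case=> f [fl fb fq]; exists f; split=> // x.
by rewrite /= /oppq_fun fq.
Qed.

Lemma oppq_osum V W (q : qform V) (r : qform W) :
  isometric (oppq (osum q r)) (osum (oppq q) (oppq r)).
Proof.
exists id; split=> //; first by exists id.
by move=> x; rewrite /= /osum_fun /= /oppq_fun /osum_fun opprD.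
Qed.

Lemma quadratic_sum V (q : V -> k) (v : nat -> V) n : quadratic q ->
  q (\sum_(i < n) v i) =
  \sum_(i < n) (q (v i) + polar q (\sum_(j < i) v j) (v i)).
Proof.
move=> hq; elim: n => [|n IHn]; first by rewrite !big_ord0 (quadratic0 hq).
rewrite !big_ord_recr /= (quadraticD q) IHn; exact/esym/addrA.
Qed.

Lemma osum_oppq V (q : qform V) :
  isometric (osum q (oppq q)) (hyperbolic (\dim {:V})).
Proof.
have hq := qf_quadratic q.
set n := \dim {:V}; pose X := vbasis {:V}.
pose e (i : nat) := X`_i.
pose c (u : V) (i : nat) : k := if insub i is Some i' then coord X i' u else 0.
have cE (i : 'I_n) u : c u i = coord X i u by rewrite /c valK.
have cl (i : nat) a u w : c (a *: u + w) i = a * c u i + c w i.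
  rewrite /c; case: insub => [i'|]; first by rewrite linearP.
  by rewrite mulr0 addr0.
have decomp u : u = \sum_(i < n) c u i *: e i.
  rewrite {1}[u](coord_vbasis (memvf u)); apply: eq_bigr => i _.
  by rewrite cE.
pose g (x : V * V) (i : 'I_n) : k :=
  c (x.1 - x.2) i * q (e i)
  + polar q (\sum_(j < i) c (x.1 - x.2) j *: e j) (e i) + polar q x.2 (e i).
pose f (x : V * V) : 'M[k]_(n, 2) :=
  \matrix_(i, j) if j == 0 then c (x.1 - x.2) i else g x i.
have subl a (x y : V * V) :
    (a *: x + y).1 - (a *: x + y).2 = a *: (x.1 - x.2) + (y.1 - y.2).
  by rewrite /= scalerBr opprD addrACA.
have fl : linear f.
  move=> a x y; apply/matrixP=> i j; rewrite !mxE; case: eqP => _.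
    by rewrite subl cl.
  rewrite /g subl cl /=.
  rewrite (eq_bigr (fun j : 'I_i => a *: (c (x.1 - x.2) j *: e j)
             + c (y.1 - y.2) j *: e j)); last first.
    by move=> l _; rewrite cl scalerDl scalerA.
  rewrite big_split -scaler_sumr /= !polarDl // !polarZl //; ring.
have f0 (x : V * V) (i : 'I_n) : f x i 0 = c (x.1 - x.2) i by rewrite mxE.
have f1 (x : V * V) (i : 'I_n) : f x i 1 = g x i by rewrite mxE.
exists f; split=> //.
- apply: linear_bij => //; last first.
    by rewrite !dimvf /dim /= /n dimvf muln2 addnn.
  move=> x y fxy; apply/eqP; rewrite -subr_eq0; apply/eqP.
  have {fxy} : f (x - y) = 0.
    by rewrite -scaleN1r addrC fl fxy scaleN1r addNr.
  move: (x - y) => {x y} z fz.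
  have z12 : z.1 - z.2 = 0.
    rewrite [LHS]decomp big1 // => i _.
    by rewrite -f0 fz mxE scale0r.
  have c0 i : c 0 i = 0.
    by rewrite /c; case: insub => [i'|//]; rewrite linear0.
  have z2 : z.2 = 0.
    apply: (qf_nondegenerate (q := q)) => y.
    rewrite polarC [y]decomp.
    suff pe (i : 'I_n) : polar q z.2 (e i) = 0.
      elim/big_ind: _ => [|u w pu pw|i _]; first exact: polar0l.
      - by rewrite polarDl // pu pw addr0.
      - by rewrite polarZl // polarC pe mulr0.
    have : f z i 1 = 0 by rewrite fz mxE.
    rewrite f1 /g z12 c0 mul0r add0r big1 => [|j _]; last by rewrite c0 scale0r.
    by rewrite polar0l // add0r.
  have z1 : z.1 = 0 by move/eqP: z12; rewrite z2 subr0 => /eqP.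
  by case: z z1 z2 {fz z12} => a b /= -> ->.
- move=> [x y]; rewrite /= /hyp_fun /osum_fun /= /oppq_fun.
  set u := x - y; have xE : x = y + u by rewrite /u addrC subrK.
  rewrite (eq_bigr (fun i : 'I_n => (q (c u i *: e i)
     + polar q (\sum_(j < i) c u j *: e j) (c u i *: e i))
     + polar q y (c u i *: e i))); last first.
    move=> i _; rewrite f0 f1 /g /= -/u hq.1.
    by rewrite ![polar q _ (_ *: _)]polarC !polarZl // ![polar q (e i) _]polarC; ring.
  rewrite big_split /= -(quadratic_sum (fun i => c u i *: e i)) // -decomp.
  have -> : \sum_(i < n) polar q y (c u i *: e i) = polar q y u.
    rewrite polarC [in RHS](decomp u).
    elim/big_ind2: _ => [|a1 a2 b1 b2 -> ->|i _]; first by rewrite polar0l.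
      by rewrite polarDl.
    by rewrite polarC.
  by rewrite xE (quadraticD q) -(addrA (q y)) [RHS]addrC addKr.
Qed.

Lemma witt_oppq V W (q : qform V) (r : qform W) :
  witt_equiv q r -> witt_equiv (oppq q) (oppq r).
Proof.
have hyp_opp m : isometric (oppq (hyperbolic m)) (hyperbolic m).
  exists (fun A : 'M[k]_(m, 2) => \matrix_(i, j) if j == 0 then A i 0 else - A i 1); split.
  - move=> a x y; apply/matrixP=> i j; rewrite !mxE.
    by case: eqP => // _; ring.
  - apply: linear_bij => //.
      move=> a x y; apply/matrixP=> i j; rewrite !mxE.
      by case: eqP => // _; ring.
    move=> A B AB; apply/matrixP=> i j; move/matrixP/(_ i j): AB; rewrite !mxE.
    case: (j =P 0) => [->//|/eqP j0].
    have -> : j = 1 by case: j j0 => [[|[|//]] ?] //= _; apply/val_inj.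
    exact: oppr_inj.
  - move=> A; rewrite /= /oppq_fun /hyp_fun -sumrN; apply: eq_bigr => i _.
    by rewrite !mxE /= mulrN.
case=> m [n h]; exists m, n.
apply: isometric_trans (isometric_osum (isometric_refl _)
  (isometric_sym (hyp_opp m))) _.
apply: isometric_trans _ (isometric_osum (isometric_refl _) (hyp_opp n)).
apply: isometric_trans (isometric_sym (oppq_osum _ _)) _.
apply: isometric_trans _ (oppq_osum _ _).
exact: isometric_oppq.
Qed.

End QuadraticForms.

HB.instance Definition _ (k : fieldType) (V : vectType k) :=
  gen_eqMixin (qform V).
HB.instance Definition _ (k : fieldType) (V : vectType k) :=
  gen_choiceMixin (qform V).

Section IsometryClass.
Variables (k : fieldType) (V : vectType k).

Definition isometric_rel (q r : qform V) : bool := `[< isometric q r >].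

Lemma isometric_rel_refl : reflexive isometric_rel.
Proof. by move=> q; apply/asboolP; apply: isometric_refl. Qed.

Lemma isometric_rel_sym : symmetric isometric_rel.
Proof. by move=> q r; apply/asboolP/asboolP; apply: isometric_sym. Qed.

Lemma isometric_rel_trans : transitive isometric_rel.
Proof.
move=> r q s /asboolP qr /asboolP rs; apply/asboolP.
exact: isometric_trans qr rs.
Qed.

Canonical isometric_equiv :=
  EquivRel isometric_rel isometric_rel_refl isometric_rel_sym
    isometric_rel_trans.

Definition isometry_class := {eq_quot isometric_rel}%qT.
HB.instance Definition _ := Choice.on isometry_class.
HB.instance Definition _ := EqQuotient.on isometry_class.

End IsometryClass.

(** Every quadratic space is isometric to one on some [k^n]; using only the
    latter makes the Witt group a quotient of a type in the universe of [k]. *)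
Record qspace (k : fieldType) :=
  QSpace { qs_dim : nat; qs_form : qform 'rV[k]_qs_dim }.

HB.instance Definition _ (k : fieldType) := gen_eqMixin (qspace k).
HB.instance Definition _ (k : fieldType) := gen_choiceMixin (qspace k).

Section WittGroup.
Variable k : fieldType.

Definition witt_rel (x y : qspace k) : bool :=
  `[< witt_equiv (qs_form x) (qs_form y) >].

Lemma witt_rel_refl : reflexive witt_rel.
Proof. by move=> q; apply/asboolP; apply: witt_refl. Qed.

Lemma witt_rel_sym : symmetric witt_rel.
Proof. by move=> q r; apply/asboolP/asboolP; apply: witt_sym. Qed.

Lemma witt_rel_trans : transitive witt_rel.
Proof.
move=> r q s /asboolP qr /asboolP rs; apply/asboolP.
exact: witt_trans qr rs.
Qed.

Canonical witt_rel_equiv :=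
  EquivRel witt_rel witt_rel_refl witt_rel_sym witt_rel_trans.

Definition witt := {eq_quot witt_rel}%qT.
HB.instance Definition _ := Choice.on witt.
HB.instance Definition _ := EqQuotient.on witt.

Definition witt_class (V : vectType k) (q : qform V) : witt :=
  (\pi_witt (QSpace (coord_form q)))%qT.

Lemma coord_form_isometric (V : vectType k) (q : qform V) :
  isometric (coord_form q) q.
Proof. exact: pullback_isometric. Qed.

Lemma coord_form_witt (V : vectType k) (q : qform V) :
  witt_equiv (coord_form q) q.
Proof. exact: isometric_witt (coord_form_isometric q). Qed.

Lemma witt_classP (V W : vectType k) (q : qform V) (r : qform W) :
  witt_class q = witt_class r <-> witt_equiv q r.
Proof.
split=> [/eqmodP/asboolP/= h|h].
  apply: witt_trans (witt_sym (coord_form_witt q)) _.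
  exact: witt_trans h (coord_form_witt r).
apply/eqmodP/asboolP => /=.
apply: witt_trans (coord_form_witt q) _.
exact: witt_trans h (witt_sym (coord_form_witt r)).
Qed.

Lemma witt_class_repr (u : witt) : witt_class (qs_form (repr u)) = u.
Proof.
rewrite -[RHS]reprK; case: (repr u) => n q.
by apply/eqmodP/asboolP; apply: coord_form_witt.
Qed.

Definition witt_add (u v : witt) : witt :=
  witt_class (osum (qs_form (repr u)) (qs_form (repr v))).

Definition witt_opp (u : witt) : witt := witt_class (oppq (qs_form (repr u))).

Definition witt_zero : witt := witt_class (hyperbolic k 0).

Lemma witt_class_osum (V W : vectType k) (q : qform V) (r : qform W) :
  witt_class (osum q r) = witt_add (witt_class q) (witt_class r).
Proof.
apply/witt_classP; apply: witt_osum; apply/witt_classP;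
  by rewrite witt_class_repr.
Qed.

Lemma witt_class_oppq (V : vectType k) (q : qform V) :
  witt_class (oppq q) = witt_opp (witt_class q).
Proof.
by apply/witt_classP/witt_oppq/witt_classP; rewrite witt_class_repr.
Qed.

Lemma witt_class_hyperbolic m : witt_class (hyperbolic k m) = witt_zero.
Proof.
apply/witt_classP; exists 0%N, m.
exact: osumC.
Qed.

Lemma witt_addA : associative witt_add.
Proof.
move=> u v w; rewrite -[u]witt_class_repr -[v]witt_class_repr.
rewrite -[w]witt_class_repr -!witt_class_osum.
by apply/witt_classP/isometric_witt/osumA.
Qed.

Lemma witt_addC : commutative witt_add.
Proof.
move=> u v; rewrite -[u]witt_class_repr -[v]witt_class_repr -!witt_class_osum.
by apply/witt_classP/isometric_witt/osumC.
Qed.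

Lemma witt_add0 : left_id witt_zero witt_add.
Proof.
move=> u; rewrite witt_addC -[u]witt_class_repr /witt_zero -witt_class_osum.
by apply/witt_classP/isometric_witt/osum_hyperbolic0.
Qed.

Lemma witt_addN : left_inverse witt_zero witt_opp witt_add.
Proof.
move=> u; rewrite witt_addC -[u]witt_class_repr -witt_class_oppq.
rewrite -witt_class_osum -(witt_class_hyperbolic (\dim {: 'rV[k]_(qs_dim (repr u))})).
by apply/witt_classP/isometric_witt/osum_oppq.
Qed.

HB.instance Definition _ :=
  GRing.isZmodule.Build witt witt_addA witt_addC witt_add0 witt_addN.

Lemma witt_classD (V W : vectType k) (q : qform V) (r : qform W) :
  witt_class (osum q r) = witt_class q + witt_class r.
Proof. exact: witt_class_osum. Qed.

(** The dimension of an anisotropic representative of [u]; Witt's theorem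
    provides its existence and uniqueness, so the default [0] is not used. *)
Definition anisotropic_dim (u : witt) : nat :=
  xget 0%N [set n : nat | exists q : qform 'rV[k]_n,
    anisotropic q /\ witt_class q = u]%classic.

(** Independent of the representative, see [witt_of_isometry_classE]. *)
Definition witt_of_isometry_class (V : vectType k) (c : isometry_class V) :
  witt := witt_class (repr c).

Lemma witt_of_isometry_classE (V : vectType k) (q : qform V) :
  witt_of_isometry_class (\pi_(isometry_class V) q)%qT = witt_class q.
Proof.
apply/witt_classP/isometric_witt.
by have /eqmodP/asboolP := reprK (\pi_(isometry_class V) q)%qT.
Qed.

End WittGroup.

Section Decomposition.
Variables (k : fieldType) (V : vectType k) (A : finType) (M : A -> {vspace V}).

Definition chi (i : nat) : nat := #|[set a | \dim (M a) == i]|.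

Definition chi3p : nat := (\sum_(3 <= i < (\dim {:V}).+1) chi i)%N.

(** The ways of assigning to each [M a] a nondegenerate quadratic form, up to
    isometry, with sum [u] in the Witt group. *)
Definition assignments (u : witt k) :
    set (forall a, isometry_class (subvs_of (M a))) :=
  [set c | \sum_a witt_of_isometry_class (c a) = u]%classic.

End Decomposition.

Arguments assignments {k V A} M u _.

(** The closest integer; ties, which are rounded up, play no role below. *)
Definition nearest_int (x : rat) : int := Num.floor (x + 2^-1).

Definition epsilon (n0 c2 : nat) : int :=
  if (n0 == 0%N) && ~~ odd c2 || (n0 == 4%N) && odd c2
  then (-1) ^+ c2 else 0.

Definition T_formula (n0 c1 c2 c3 : nat) : rat :=
  if (1 <= c3)%N then 8^-1 * 4 ^+ c1 * 7 ^+ c2 * 8 ^+ c3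
  else if (1 <= c1)%N then
    8^-1 * 4 ^+ c1 * 7 ^+ c2 + (2 - n0%:R) * 2 ^ (c1%:Z - 2)
  else (nearest_int (8^-1 * 7 ^+ c2) + epsilon n0 c2)%:~R.

(* Main.v *)
(* An isometry class of forms on a space of dimension [i] is the same thing as a
   Witt class whose anisotropic dimension is at most [i] and has the parity of
   [i] (Witt cancellation, obtained here from Lagrangian subspaces).  Springer's
   decomposition and Hensel's lemma make the Witt group of [k] two copies of the
   Witt group of the residue field, i.e. 16 classes, described by explicit
   coordinates in which addition and the anisotropic dimension are computable.
   The number of solutions then depends only on the anisotropic dimension of
   the target, and adding one subspace convolves this function with the
   indicator of the classes realised in its dimension; [count_formula] is the
   closed form stable under these convolutions. *)

Require Import Defs.
From HB Require Import structures.
From mathcomp Require Import fingroup cyclic.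
From mathcomp Require Import all_boot all_order all_algebra.
From mathcomp Require Import all_classical all_reals.
From mathcomp Require Import ring lra zify.

Set Implicit Arguments.
Unset Strict Implicit.
Unset Printing Implicit Defensive.

Import Order.TTheory GRing.Theory Num.Theory.
Local Open Scope ring_scope.

(** * Witt decomposition and cancellation over an arbitrary field *)

Ltac dim_lia :=
  repeat match goal with H : context [dimv _] |- _ => move: H end;
  repeat match goal with
    |- context [@dimv ?K ?V ?U] => move: (@dimv K V U) => ? end;
  lia.

(** Hyperbolic planes have dimension 2, so this is the condition for a Witt class of anisotropic
    dimension [n] to contain a form of dimension [i]. *)
Definition admissible (i n : nat) : bool := (n <= i)%N && (odd n == odd i).

Section WittTheory.
Variable k : fieldType.
Implicit Types V W U : vectType k.

Definition linear_fun_of V W (f : V -> W) (fl : linear f) : {linear V -> W} :=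
  HB.pack f (GRing.isLinear.Build k V W *:%R f fl).

Lemma linfun_ofE V W (f : V -> W) (fl : linear f) x :
  linfun (linear_fun_of fl) x = f x.
Proof. by rewrite lfunE. Qed.

Lemma linear_inj V W (f : V -> W) : linear f ->
  (forall x, f x = 0 -> x = 0) -> injective f.
Proof.
move=> fl f0 x y fxy; apply/eqP; rewrite -subr_eq0; apply/eqP/f0.
by rewrite addrC -scaleN1r fl fxy scaleN1r addNr.
Qed.

Lemma dimv_bij V W (f : V -> W) : linear f -> bijective f ->
  \dim {:V} = \dim {:W}.
Proof.
move=> fl [g fK gK]; pose h : 'Hom(V, W) := linfun (linear_fun_of fl).
have h0 : lker h == 0%VS.
  by apply/lker0P=> x y; rewrite !linfun_ofE; apply: can_inj fK _ _.
rewrite -(@limg_dim_eq _ _ _ h fullv) ?(eqP h0) ?capv0 //.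
suff -> : limg h = fullv by [].
apply/eqP; rewrite eqEsubv subvf; apply/subvP=> y _.
by rewrite -(gK y) -(linfun_ofE fl) memv_img ?memvf.
Qed.

Lemma dimv_eq_bij V W : \dim {:V} = \dim {:W} ->
  exists f : V -> W, linear f /\ bijective f.
Proof.
rewrite !dimvf => dVW.
have [c [cl cb]] : exists c : 'rV[k]_(dim V) -> 'rV[k]_(dim W),
    linear c /\ bijective c.
  by rewrite -dVW; exists id; split=> //; exists id.
have [g gK g'K] := @r2v_bij k V.
exists (fun x => VectorInternalTheory.r2v (c (g x))); split.
  by move=> a x y; rewrite (linear_can (@r2v_linear k V) gK g'K) cl r2v_linear.
apply: bij_comp (@r2v_bij k W) (bij_comp cb _).
by exists (VectorInternalTheory.r2v : 'rV_(dim V) -> V).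
Qed.

Lemma isometric_dim V W (q : qform V) (r : qform W) :
  isometric q r -> \dim {:V} = \dim {:W}.
Proof. by case=> f [fl fb _]; exact: dimv_bij fl fb. Qed.

Lemma dim_prod V W : \dim {: (V * W)%type} = (\dim {:V} + \dim {:W})%N.
Proof. by rewrite !dimvf. Qed.

Lemma dim_mx m n : \dim {: 'M[k]_(m, n)} = (m * n)%N.
Proof. by rewrite dimvf. Qed.

Lemma dim_subvs V (U : {vspace V}) : \dim {: subvs_of U} = \dim U.
Proof. by rewrite dimvf. Qed.

Section Split.
Variables (V W : vectType k) (q : qform V) (r : qform W) (g : W -> V).
Hypotheses (gl : linear g) (gq : forall w, q (g w) = r w).

Let qq := qf_quadratic q.
Let rq := qf_quadratic r.

Lemma isometry_polar w w' : polar q (g w) (g w') = polar r w w'.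
Proof. by rewrite /polar -linear_funD // !gq. Qed.

Lemma polar_sumr U (s : qform U) y n (c : 'I_n -> k) (e : 'I_n -> U) :
  polar s y (\sum_i c i *: e i) = \sum_i c i * polar s y (e i).
Proof.
have sq := qf_quadratic s.
rewrite polarC; elim/big_ind2: _ => [|a b a' b' <- <-|i _].
- exact: polar0l.
- exact: polarDl.
- by rewrite polarZl // polarC.
Qed.

(* The projection to [W] along the orthogonal complement of its image. *)
Lemma orth_proj_exists : exists P : V -> W, linear P /\
  forall x w, polar r (P x) w = polar q x (g w).
Proof.
set n := \dim {:W}; pose b := vbasis {:W}.
have expand w : w = \sum_(i < n) coord b i w *: b`_i.
  by rewrite -coord_vbasis ?memvf.
(* Nondegeneracy of [r] makes [adj] an isomorphism, so [P x] is determined by the values of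
   [polar q x] on the image of the basis. *)
pose adj (w : W) : 'rV[k]_n := \row_i polar r w b`_i.
have adjl : linear adj.
  by move=> a x y; apply/rowP=> i; rewrite !mxE polarDl // polarZl.
have [adj' adjK adj'K] : bijective adj.
  apply: linear_bij => //; last by rewrite dim_mx mul1n.
  apply: linear_inj => // w w0; apply: (qf_nondegenerate (q := r)) => y.
  rewrite [y]expand polar_sumr big1 // => i _.
  by move/rowP/(_ i): w0; rewrite !mxE => ->; rewrite mulr0.
pose row_q (x : V) : 'rV[k]_n := \row_i polar q x (g b`_i).
have rowl : linear row_q.
  by move=> a x y; apply/rowP=> i; rewrite !mxE polarDl // polarZl.
exists (adj' \o row_q); split.
  by move=> a x y /=; rewrite rowl (linear_can adjl).
move=> x w /=; set w' := adj' _.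
have E (i : 'I_n) : polar r w' b`_i = polar q x (g b`_i).
  by have /rowP/(_ i) := adj'K (row_q x); rewrite !mxE.
have gs : g w = \sum_(i < n) coord b i w *: g b`_i.
  rewrite {1}[w]expand; elim/big_ind2: _ => [|a a' c c' <- <-|i _].
  - exact: linear_fun0.
  - exact: linear_funD.
  - exact: linear_funZ.
rewrite gs {1}[w]expand !polar_sumr; apply: eq_bigr => i _.
by rewrite E.
Qed.

(** The kernel of the projection [P] is the orthogonal complement of the image of [g], and it
    inherits a nondegenerate form. *)
Lemma osum_split : exists n (s : qform 'rV[k]_n), isometric q (osum r s).
Proof.
have [P [Pl PE]] := orth_proj_exists.
have Pg w : P (g w) = w.
  apply/eqP; rewrite -subr_eq0; apply/eqP/(qf_nondegenerate (q := r)) => y.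
  by rewrite addrC -scaleN1r polarDl // polarZl // PE isometry_polar; ring.
pose K := lker (linfun (linear_fun_of Pl)).
have KP x : (x \in K) = (P x == 0) by rewrite memv_ker linfun_ofE.
have Pc x : P (x - g (P x)) = 0.
  by rewrite addrC -scaleN1r Pl Pg scaleN1r addNr.
pose s0 (y : subvs_of K) := q (vsval y).
have s0p x y : polar s0 x y = polar q (vsval x) (vsval y).
  by rewrite /polar /s0 raddfD.
have s0q : quadratic s0.
  split=> [a x|y a x z] /=; first by rewrite /s0 linearZ qq.1.
  by rewrite !s0p linearP polarDl // polarZl.
have s0n : Defs.nondegenerate s0.
  move=> y y0; apply: val_inj; apply: (qf_nondegenerate (q := q)) => z /=.
  have yK : P (vsval y) = 0 by apply/eqP; rewrite -KP subvsP.
  (* A vector of the kernel is orthogonal to [g (P z)], so its pairing with [z] only sees the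
     component [z - g (P z)] in [K]. *)
  rewrite -[z](subrK (g (P z))) polarC polarDl // ![polar q _ (vsval y)]polarC.
  rewrite -PE yK polar0l // addr0.
  have zK : z - g (P z) \in K by rewrite KP Pc.
  by rewrite -(vsprojK zK) -s0p y0.
pose s := QForm s0q s0n.
exists (dim (subvs_of K)), (coord_form s).
apply: isometric_trans (isometric_osum (isometric_refl r)
  (isometric_sym (coord_form_isometric s))).
have cK x : x - g (P x) \in K by rewrite KP Pc.
exists (fun x => (P x, vsproj K (x - g (P x)))); split.
- move=> a x y; rewrite /= (Pl a x y); congr pair.
  rewrite /= -linearZ -raddfD; congr (vsproj K _).
  by rewrite gl scalerBr opprD addrACA.
- exists (fun z => g z.1 + vsval z.2) => [x|[w y]] /=.
    by rewrite vsprojK // addrC subrK.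
  have yK : P (vsval y) = 0 by apply/eqP; rewrite -KP subvsP.
  have -> : P (g w + vsval y) = w by rewrite linear_funD // Pg yK addr0.
  by rewrite addrAC subrr add0r vsvalK.
- move=> x; rewrite /= /osum_fun /= /s0 /= vsprojK //.
  have := Pc x; set d := x - g (P x) => Pd.
  have xE : x = g (P x) + d by rewrite addrC subrK.
  by rewrite [in RHS]xE (quadraticD q) gq polarC -PE Pd polar0l // addr0.
Qed.

End Split.

(** A nonzero vector on which [q] vanishes extends to a hyperbolic pair, whose span splits off by
    [osum_split]. *)
Lemma isotropic_split V (q : qform V) : ~ anisotropic q ->
  exists n (s : qform 'rV[k]_n), isometric q (osum s (hyperbolic k 1)).
Proof.
move=> nq; have qq := qf_quadratic q.
have [x qx x0] : exists2 x, q x = 0 & x <> 0.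
  apply: contrapT => nx; apply: nq => x qx; apply: contrapT => x0.
  by case: nx; exists x.
have [y0 xy0] : exists y, polar q x y <> 0.
  apply: contrapT => ny; apply: x0; apply: (qf_nondegenerate (q := q)) => y.
  by apply: contrapT => xy; case: ny; exists y.
pose y1 := (polar q x y0)^-1 *: y0.
have xy1 : polar q x y1 = 1.
  by rewrite polarC polarZl // (polarC _ y0) mulVf //; apply/eqP.
have xx : polar q x x = 0.
  by rewrite /polar -mulr2n -scaler_nat qq.1 qx; ring.
(* Subtracting [q y1 *: x] from [y1] makes the value vanish because [polar q x y1 = 1], and keeps
   the pairing with [x] because [polar q x x = 0]. *)
have [y xy qy] : exists2 y, polar q x y = 1 & q y = 0.
  exists ((- q y1) *: x + y1).
    by rewrite polarC polarDl // polarZl // xx mulr0 add0r polarC.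
  by rewrite (quadraticD q) qq.1 qx polarZl // xy1; ring.
pose g (A : 'M[k]_(1, 2)) : V := A 0 0 *: x + A 0 1 *: y.
have gl : linear g.
  move=> a A B; rewrite /g !mxE !scalerDl -!scalerA scalerDr.
  by rewrite addrACA.
have gq A : q (g A) = hyperbolic k 1 A.
  rewrite /= /hyp_fun big_ord1 (quadraticD q) !qq.1 qx qy !mulr0 !add0r.
  by rewrite polarZl // polarC polarZl // polarC xy mulr1.
have [n [s qs]] := osum_split gl gq.
exists n, s; exact: isometric_trans qs (osumC _ _).
Qed.

Lemma isometric_anisotropic V W (q : qform V) (r : qform W) :
  isometric q r -> anisotropic q -> anisotropic r.
Proof.
case=> f [fl [g fK gK] fq] aq y; rewrite -(gK y) fq => /aq ->.
exact: linear_fun0.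
Qed.

Lemma coord_form_anisotropic V (q : qform V) :
  anisotropic q -> anisotropic (coord_form q).
Proof. exact/isometric_anisotropic/isometric_sym/coord_form_isometric. Qed.

Lemma witt_decomposition V (q : qform V) :
  exists n m (s : qform 'rV[k]_n),
    anisotropic s /\ isometric q (osum s (hyperbolic k m)).
Proof.
move: {-1}(\dim {:V}) (leqnn (\dim {:V})) => N.
elim: N V q => [|N IHN] V q dV.
(* Base case and inductive step begin alike; in dimension 0 the split plane contradicts the
   dimension bound. *)
all: case: (pselect (anisotropic q)) => aq; first (
  exists (dim V), 0%N, (coord_form q); split;
  [exact: coord_form_anisotropic
  |apply: isometric_trans (isometric_sym (osum_hyperbolic0 _));
   exact/isometric_sym/coord_form_isometric]).
all: have [n [s qs]] := isotropic_split aq.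
all: have := isometric_dim qs; rewrite dim_prod !dim_mx => dE.
  by move: dV; rewrite dE addn2.
have [|n' [m [t [at_ st]]]] := IHN _ s.
  by rewrite dim_mx; move: dV; rewrite dE; dim_lia.
exists n', (m + 1)%N, t; split=> //.
apply: isometric_trans (osum_hypD _ _ _).
apply: isometric_trans qs _.
exact: isometric_osum st (isometric_refl _).
Qed.

(** A totally singular subspace of half the dimension. Its existence survives the removal of
    hyperbolic planes, so every form of trivial Witt class has one. *)
Definition lagrangian V (q : qform V) := exists L : {vspace V},
  (\dim {:V} <= (\dim L).*2)%N /\ forall x, x \in L -> q x = 0.

Lemma isometric_lagrangian V W (q : qform V) (r : qform W) :
  isometric q r -> lagrangian q -> lagrangian r.
Proof.
move=> qr [L [dL L0]]; have dVW := isometric_dim qr.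
case: qr => f [fl fb fq]; pose h := linfun (linear_fun_of fl).
exists (h @: L)%VS; split; last first.
  by move=> _ /memv_imgP[x xL ->]; rewrite linfun_ofE fq L0.
rewrite -dVW limg_dim_eq //; suff /eqP -> : lker h == 0%VS by rewrite capv0.
by apply/lker0P=> x y; rewrite !linfun_ofE; apply: bij_inj.
Qed.

Lemma hyperbolic_lagrangian m : lagrangian (hyperbolic k m).
Proof.
have cl : linear (fun A : 'M[k]_(m, 2) => col 1 A).
  by move=> a A B; apply/colP=> i; rewrite !mxE.
pose h := linfun (linear_fun_of cl); exists (lker h); split.
  have := limg_ker_dim h fullv; rewrite capfv => E.
  have := dimvS (subvf (limg h)); rewrite dim_mx.
  by move: E; rewrite !dim_mx; dim_lia.
move=> A; rewrite memv_ker linfun_ofE => /eqP/colP A0.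
rewrite /= /hyp_fun big1 // => i _.
by have := A0 i; rewrite !mxE => ->; rewrite mulr0.
Qed.

(** Intersect [L] with the orthogonal complement of the singular vector [e] and project to [V]. If
    [e] is outside [L], the projection is injective on the intersection; if [e] is in [L], the
    intersection is all of [L] and only the line of [e] is killed. At most one dimension is lost
    either way. *)
Lemma lagrangian_osum_hyp1 V (q : qform V) :
  lagrangian (osum q (hyperbolic k 1)) -> lagrangian q.
Proof.
case=> L [dL L0].
have pl : linear (fun z : V * 'M[k]_(1, 2) => z.2 0 1 : k^o).
  by move=> a A B; rewrite /= !mxE.
have fl : linear (fun z : V * 'M[k]_(1, 2) => z.1) by [].
pose p := linfun (linear_fun_of pl); pose f := linfun (linear_fun_of fl).
pose L1 := (L :&: lker p)%VS; exists (f @: L1)%VS.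
have L1P z : z \in L1 -> z \in L /\ z.2 0 1 = 0.
  by rewrite memv_cap memv_ker linfun_ofE => /andP[? /eqP].
split; last first.
  move=> _ /memv_imgP[z /L1P[/L0 + z0] ->].
  by rewrite linfun_ofE /= /osum_fun /= /hyp_fun big_ord1 z0 mulr0 addr0.
pose e : V * 'M[k]_(1, 2) := (0, delta_mx 0 0).
have kf z : z \in (L1 :&: lker f)%VS -> z = z.2 0 0 *: e.
  rewrite memv_cap memv_ker linfun_ofE => /andP[/L1P[_]].
  case: z => x A /= A1 /eqP ->; congr pair; first by rewrite scaler0.
  apply/matrixP=> i j; rewrite !mxE !ord1 eqxx /=.
  case: j => [[|[|//]] hj]; rewrite ?mulr1 ?mulr0 -?A1; congr (A _ _);
    exact/val_inj.
have dker := limg_ker_dim f L1; have dL1 := limg_ker_dim p L.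
have dp : (\dim (p @: L) <= 1)%N.
  by apply: leq_trans (dimvS (subvf _)) _; rewrite dimvf.
move: dL; rewrite dim_prod dim_mx => dL.
have [eL|eL] := boolP (e \in L); last first.
  have k0 : (L1 :&: lker f)%VS = 0%VS.
    apply/eqP; rewrite -subv0; apply/subvP=> z zk; rewrite memv0.
    have zE := kf _ zk; rewrite zE; have [->|c0] := eqVneq (z.2 0 0) 0.
      by rewrite scale0r.
    have /L1P[zL _] : z \in L1 by move: zk; rewrite memv_cap => /andP[].
    case/negP: eL; have -> : e = (z.2 0 0)^-1 *: z.
      by rewrite {2}zE scalerA mulVf // scale1r.
    exact: memvZ.
  by move: dker dL1; rewrite k0 dimv0 -/L1; dim_lia.
(* The form vanishes at both [z] and [z + e], and the two values differ by [z.2 0 1]. *)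
have LL1 : L1 = L.
  apply/capv_idPl/subvP=> z zL; rewrite memv_ker linfun_ofE.
  have := L0 _ (memvD zL eL); have := L0 _ zL.
  rewrite /= /osum_fun /= /hyp_fun !big_ord1 !mxE !addr0 /= => z0 ze.
  by apply/eqP; move: ze; rewrite mulrDl addrA z0 add0r mul1r.
have dk : (\dim (L1 :&: lker f) <= 1)%N.
  apply: leq_trans (_ : \dim <[e]> <= 1)%N;
    last by rewrite dim_vline; case: eqP.
  by apply: dimvS; apply/subvP=> z /kf ->; rewrite memvZ ?memv_line.
by move: dker; rewrite LL1 in dk *; dim_lia.
Qed.

Lemma lagrangian_osum_hyp V (q : qform V) m :
  lagrangian (osum q (hyperbolic k m)) -> lagrangian q.
Proof.
elim: m => [|m IHm] h; first exact: isometric_lagrangian (osum_hyperbolic0 q) h.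
apply: IHm; apply: lagrangian_osum_hyp1; apply: isometric_lagrangian h.
by rewrite -addn1; apply/isometric_sym/osum_hypD.
Qed.

Lemma witt_class0_lagrangian V (q : qform V) :
  witt_class q = 0 -> lagrangian q.
Proof.
move/witt_classP=> [m [n h]]; apply: (@lagrangian_osum_hyp _ _ m).
apply: isometric_lagrangian (hyperbolic_lagrangian n).
apply: isometric_trans (isometric_sym h).
exact: isometric_trans (isometric_sym (osum_hyperbolic0 _)) (osumC _ _).
Qed.

(* A Lagrangian of [q - r] meets both summands trivially, so it is the graph
   of an isometry. *)
Lemma anisotropic_witt_isometric V W (q : qform V) (r : qform W) :
  anisotropic q -> anisotropic r -> witt_class q = witt_class r ->
  isometric q r.
Proof.
move=> aq ar qr.
have : witt_class (osum q (Defs.oppq r)) = 0.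
  by rewrite witt_classD witt_class_oppq qr; apply: (addrN (witt_class r)).
case/witt_class0_lagrangian=> L [dL L0].
have LP z : z \in L -> q z.1 = r z.2.
  by move/L0 => /= /eqP; rewrite /osum_fun /= /oppq_fun subr_eq0 => /eqP.
pose f1 (z : subvs_of L) := (vsval z).1.
pose f2 (z : subvs_of L) := (vsval z).2.
have l1 : linear f1 by move=> a x y; rewrite /f1 linearP.
have l2 : linear f2 by move=> a x y; rewrite /f2 linearP.
have fE z : q (f1 z) = r (f2 z) by apply/LP/subvsP.
have i1 : injective f1.
  apply: linear_inj => // z z1; apply: val_inj => /=.
  have : f2 z = 0 by apply: ar; rewrite -fE z1 (quadratic0 (qf_quadratic q)).
  by move: z1; rewrite /f1 /f2; case: (vsval z) => ? ? /= -> ->.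
have i2 : injective f2.
  apply: linear_inj => // z z2; apply: val_inj => /=.
  have : f1 z = 0 by apply: aq; rewrite fE z2 (quadratic0 (qf_quadratic r)).
  by move: z2; rewrite /f1 /f2; case: (vsval z) => ? ? /= -> ->.
have dle U (f : subvs_of L -> U) : linear f -> injective f ->
    (\dim L <= \dim {:U})%N.
  move=> fl fi; rewrite -dim_subvs.
  rewrite -(@limg_dim_eq _ _ _ (linfun (linear_fun_of fl))).
    exact/dimvS/subvf.
  apply/eqP; rewrite capfv; apply/lker0P => x y; rewrite !linfun_ofE; exact: fi.
have d1 := dle _ _ l1 i1; have d2 := dle _ _ l2 i2.
move: dL; rewrite dim_prod => dL.
(* Injectivity bounds [\dim L] by the dimensions of [V] and [W], while [dL] bounds its double below
   by their sum: all three are equal. *)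
have [g gK g'K] : bijective f1.
  by apply: linear_bij => //; rewrite dim_subvs; dim_lia.
have b2 : bijective f2 by apply: linear_bij => //; rewrite dim_subvs; dim_lia.
exists (f2 \o g); split=> [a x y||x] /=.
- by rewrite (linear_can l1 gK g'K) l2.
- by apply: bij_comp => //; exists f1.
- by rewrite -fE g'K.
Qed.

(** The anisotropic parts are isometric, and equal total dimensions then force equal numbers of
    hyperbolic planes. *)
Lemma witt_cancellation V W (q : qform V) (r : qform W) :
  \dim {:V} = \dim {:W} -> witt_class q = witt_class r -> isometric q r.
Proof.
move=> dVW qr.
have [n [m [s [as_ qs]]]] := witt_decomposition q.
have [n' [m' [t [at_ rt]]]] := witt_decomposition r.
have E U U' (x : qform U) (y : qform U') l :
    isometric x (osum y (hyperbolic k l)) -> witt_class x = witt_class y.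
  move/isometric_witt/witt_classP => ->.
  rewrite witt_classD witt_class_hyperbolic.
  exact: addr0.
have st : isometric s t.
  apply: anisotropic_witt_isometric => //.
  by rewrite -(E _ _ _ _ _ qs) qr (E _ _ _ _ _ rt).
have mm' : m = m'.
  have := isometric_dim st; have := isometric_dim qs; have := isometric_dim rt.
  by rewrite !dim_prod !dim_mx -dVW; dim_lia.
apply: isometric_trans qs _; apply: isometric_trans (isometric_sym rt).
by rewrite mm'; apply: isometric_osum st (isometric_refl _).
Qed.

(** Whichever dimension [xget] selects, its anisotropic form is isometric to [q]. *)
Lemma anisotropic_dim_class V (q : qform V) : anisotropic q ->
  anisotropic_dim (witt_class q) = \dim {:V}.
Proof.
move=> aq; rewrite /anisotropic_dim; case: xgetP => [n -> [s [as_ sq]]|].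
  have := isometric_dim (anisotropic_witt_isometric as_ aq sq).
  by rewrite dim_mx mul1n.
move=> /(_ (dim V)) []; exists (coord_form q); split.
  exact: coord_form_anisotropic.
exact/witt_classP/coord_form_witt.
Qed.

Lemma witt_class_iso V W (q : qform V) (r : qform W) : isometric q r ->
  witt_class q = witt_class r.
Proof. by move/isometric_witt/witt_classP. Qed.

Lemma witt_decomposition_dim V (q : qform V) : exists m,
  \dim {:V} = (anisotropic_dim (witt_class q) + m.*2)%N.
Proof.
have [n [m [s [as_ qs]]]] := witt_decomposition q; exists m.
rewrite (witt_class_iso qs) witt_classD witt_class_hyperbolic addr0.
rewrite anisotropic_dim_class // (isometric_dim qs) dim_prod !dim_mx; dim_lia.
Qed.

Lemma anisotropic_repr (u : witt k) :
  exists q : qform 'rV[k]_(anisotropic_dim u),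
    anisotropic q /\ witt_class q = u.
Proof.
have [n [m [s [as_ qs]]]] := witt_decomposition (qs_form (repr u)).
have su : witt_class s = u.
  rewrite -[RHS]witt_class_repr (witt_class_iso qs) witt_classD.
  by rewrite witt_class_hyperbolic [RHS]addr0.
have dE : anisotropic_dim u = n.
  by rewrite -su anisotropic_dim_class // dim_mx mul1n.
by rewrite dE; exists s.
Qed.

Lemma witt_of_isometry_class_inj V :
  injective (@witt_of_isometry_class k V).
Proof.
move=> c d; rewrite /witt_of_isometry_class => cd.
rewrite -[c]reprK -[d]reprK; apply/eqmodP/asboolP.
exact: witt_cancellation.
Qed.

(** Together with injectivity, this turns counting isometry classes into counting Witt classes. *)
Lemma witt_of_isometry_class_image V (u : witt k) :
  (exists c : isometry_class V, witt_of_isometry_class c = u) <->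
  admissible (\dim {:V}) (anisotropic_dim u).
Proof.
rewrite /admissible; split=> [[c <-]|/andP[le_uV /eqP odd_uV]].
  have [m ->] := witt_decomposition_dim (repr c).
  by rewrite leq_addr oddD odd_double addbF eqxx.
have [q [aq qu]] := anisotropic_repr u.
pose m := (\dim {:V} - anisotropic_dim u)./2.
have [|f [fl fb]] := @dimv_eq_bij V
    ('rV[k]_(anisotropic_dim u) * 'M[k]_(m, 2))%type.
  rewrite dim_prod !dim_mx mul1n muln2 /m -{1}(subnKC le_uV); congr addn.
  by rewrite even_halfK // oddB // odd_uV addbb.
exists (\pi_(isometry_class V) (pullback (osum q (hyperbolic k m)) fl fb))%qT.
rewrite witt_of_isometry_classE (witt_class_iso (pullback_isometric _ _ _)).
by rewrite witt_classD witt_class_hyperbolic qu [LHS]addr0.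
Qed.

End WittTheory.

(** * Valuations, residues and square roots in a local field *)

Section LocalField.
Variables (k : fieldType) (K : local_field k).
Local Notation res := (lf_res K).

(** The powers of the maximal ideal: unlike [valu], which takes the default value 0 at 0, [vge]
    treats 0 correctly. *)
Definition vge (N : int) (x : k) : bool := (N%:E <= lf_val K x)%E.
Definition valu (x : k) : int := fine (lf_val K x).

Lemma lf_valE x : x != 0 -> lf_val K x = (valu x)%:E%E.
Proof.
move=> x0; rewrite /valu; have := lf_val_ninfty K x; have := lf_val_pinfty K x.
by rewrite (negPf x0); case: (lf_val K x).
Qed.

Lemma vgeE N x : x != 0 -> vge N x = (N <= valu x).
Proof. by move=> x0; rewrite /vge lf_valE // lee_fin. Qed.

Lemma vge0 N : vge N 0.
Proof.
have := lf_val_pinfty K 0; rewrite eqxx => /eqP v0.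
by rewrite /vge v0 leey.
Qed.

Lemma valuM x y : x != 0 -> y != 0 -> valu (x * y) = valu x + valu y.
Proof.
move=> x0 y0; have := lf_valM K x y.
by rewrite !lf_valE ?mulf_neq0 // -EFinD => -[].
Qed.

Lemma valu1 : valu 1 = 0.
Proof.
by have := @valuM 1 1 (oner_neq0 _) (oner_neq0 _); rewrite mulr1; lia.
Qed.

Lemma valuN x : valu (- x) = valu x.
Proof.
have [->|x0] := eqVneq x 0; first by rewrite oppr0.
have n1 : -1 != 0 :> k by rewrite oppr_eq0 oner_neq0.
have := valuM n1 n1; rewrite mulrNN mulr1 valu1 => v1.
by rewrite -mulN1r valuM //; lia.
Qed.

Lemma valuV x : valu x^-1 = - valu x.
Proof.
have [->|x0] := eqVneq x 0.
  rewrite invr0 /valu; have := lf_val_pinfty K 0; rewrite eqxx => /eqP -> /=.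
  by rewrite oppr0.
by have := valuM x0 (invr_neq0 x0); rewrite mulfV // valu1; lia.
Qed.

Lemma valu_surj (h : int) : exists2 b : k, b != 0 & valu b = h.
Proof.
have [c cv] := lf_val_norm K.
have c0 : c != 0 by rewrite -(lf_val_pinfty K) cv.
have vc : valu c = 1 by move: cv; rewrite (lf_valE c0) => -[].
have pow n : valu (c ^+ n) = n%:Z.
  elim: n => [|n IHn]; first by rewrite expr0 valu1.
  by rewrite exprS valuM ?expf_neq0 // vc IHn; lia.
case: h => n; first by exists (c ^+ n); rewrite ?expf_neq0.
by exists (c ^+ n.+1)^-1; rewrite ?invr_eq0 ?expf_neq0 // valuV pow; lia.
Qed.

Lemma vgeD N x y : vge N x -> vge N y -> vge N (x + y).
Proof.
move=> Nx Ny; apply: le_trans _ (lf_valD K x y).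
by rewrite le_min; apply/andP.
Qed.

Lemma vgeN N x : vge N x -> vge N (- x).
Proof.
have [->|x0] := eqVneq x 0; first by rewrite oppr0.
by rewrite !vgeE ?oppr_eq0 // valuN.
Qed.

Lemma vgeB N x y : vge N x -> vge N y -> vge N (x - y).
Proof. by move=> Nx Ny; apply/vgeD/vgeN. Qed.

Lemma vgeM M N x y : vge M x -> vge N y -> vge (M + N) (x * y).
Proof.
have [->|x0] := eqVneq x 0; first by rewrite mul0r !vge0.
have [->|y0] := eqVneq y 0; first by rewrite mulr0 !vge0.
by rewrite !vgeE ?mulf_neq0 // valuM //; lia.
Qed.

Lemma vge_le M N x : M <= N -> vge N x -> vge M x.
Proof. by move=> MN; apply: le_trans; rewrite lee_fin. Qed.

Lemma vge_eq0 x : (forall N, vge N x) -> x = 0.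
Proof.
move=> xN; apply/eqP/negPn/negP => x0.
by have := xN (valu x + 1); rewrite vgeE //; lia.
Qed.

Lemma res_eq0 x : vge 0 x -> (res x == 0) = vge 1 x.
Proof. by move=> x0; rewrite lf_res_ker. Qed.

Lemma vge01 : vge 0 1.
Proof. by rewrite vgeE ?oner_neq0 // valu1. Qed.

Lemma vge_mul0 x y : vge 0 x -> vge 0 y -> vge 0 (x * y).
Proof. by move=> x0 y0; rewrite -[0]addr0 vgeM. Qed.

Lemma res0 : res 0 = 0.
Proof. by apply/eqP; rewrite res_eq0 ?vge0. Qed.

Lemma resN x : vge 0 x -> res (- x) = - res x.
Proof.
move=> x0; apply/eqP; rewrite -addr_eq0 -(lf_resD (vgeN x0) x0).
by rewrite addNr res0.
Qed.

Lemma resB x y : vge 0 x -> vge 0 y -> res (x - y) = res x - res y.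
Proof. by move=> x0 y0; rewrite (lf_resD x0 (vgeN y0)) resN. Qed.

Lemma res_unit x : vge 0 x -> res x != 0 -> x != 0 /\ valu x = 0.
Proof.
move=> x0 rx; have xn0 : x != 0 by apply: contraNneq rx => ->; rewrite res0.
by split=> //; move: rx (x0); rewrite res_eq0 // !vgeE //; lia.
Qed.

Lemma unit_res x : x != 0 -> valu x = 0 -> vge 0 x /\ res x != 0.
Proof. by move=> x0 vx; rewrite res_eq0 !vgeE // vx. Qed.

Lemma resV x : x != 0 -> valu x = 0 -> res x^-1 = (res x)^-1.
Proof.
move=> x0 vx; have [ix rx] := unit_res x0 vx.
have ix' : vge 0 x^-1 by rewrite vgeE ?invr_neq0 // valuV vx.
by apply: (mulfI rx); rewrite -lf_resM // !mulfV // lf_res1.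
Qed.

Hypothesis res2 : (2 : lf_resfield K) != 0.

Lemma res_two : res 2 = 2.
Proof. by rewrite (lf_resD vge01 vge01) lf_res1. Qed.

Lemma two_unit : (2 : k) != 0 /\ valu 2 = 0.
Proof. by apply: res_unit; rewrite ?res_two //; apply: vgeD vge01 vge01. Qed.

(** Hensel's lemma for square roots near 1; the iteration contracts because 2 is a unit. *)
Lemma sqrt_1p m : vge 1 m -> exists z, (1 + z) ^+ 2 = 1 + m.
Proof.
move=> m1; have [t0 vt] := two_unit.
have i2 : vge 0 2^-1 by rewrite vgeE ?invr_neq0 // valuV vt.
(* the fixed-point iteration for [2 z + z ^ 2 = m] *)
pose s n := iter n (fun z => (m - z ^+ 2) / 2) 0.
have sS n : s n.+1 = (m - s n ^+ 2) / 2 by [].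
have vs n : vge 1 (s n).
  elim: n => [|n IHn]; first exact: vge0.
  rewrite sS -[1]addr0 vgeM // vgeB //.
  by rewrite expr2; apply: vge_le (vgeM IHn IHn).
(* Each difference is minus half the previous one times [s n.+1 + s n], which has positive
   valuation, so the valuation grows by at least one. *)
have step n : vge n%:Z (s n.+1 - s n).
  elim: n => [|n IHn].
    by apply: vgeB; apply: vge_le (vs _).
  have -> : s n.+2 - s n.+1 = - ((s n.+1 - s n) * (s n.+1 + s n) / 2).
    by rewrite [s n.+2]sS {2}[s n.+1]sS; field.
  apply: vgeN; have -> : n.+1%:Z = n%:Z + 1 + 0 by lia.
  by rewrite vgeM // vgeM // vgeD.
have tail n d : vge n%:Z (s (n + d)%N - s n).
  elim: d => [|d IHd]; first by rewrite addn0 subrr vge0.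
  rewrite addnS -(subrK (s (n + d)%N) (s _)) -addrA vgeD //.
  by apply: vge_le (step _); lia.
have [N|l sl] := lf_complete (l := K) (s := s).
  have far i j : (`|N| <= j)%N -> (j <= i)%N -> vge N (s i - s j).
    move=> Nj ji; rewrite -(subnKC ji); apply: vge_le (tail _ _); lia.
  exists `|N|%N => i j Ni Nj; have [ji|ij] := leqP j i; first exact: far.
  by rewrite -opprB; apply/vgeN/far => //; apply: ltnW.
exists l; suff E : 2 * l + l ^+ 2 - m = 0.
  by rewrite -[m](subrK (2 * l + l ^+ 2)) -opprB E; ring.
(* The defect is rewritten through the distances from [l] to two consecutive iterates. Taking [N']
   at least 1 also places [l] in the maximal ideal. *)
apply: vge_eq0 => N; pose N' := Num.max 1 N.
have [n0 sln] := sl N'.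
have big n : (n0 <= n)%N -> vge N' (s n - l) by apply: sln.
have l1 : vge 1 l.
  rewrite -[l](subKr (s n0)) vgeB //.
  by apply: vge_le (big _ (leqnn _)); rewrite /N'; lia.
have -> : 2 * l + l ^+ 2 - m =
    - (2 * (s n0.+1 - l)) - (s n0 - l) * (l + s n0).
  by rewrite sS; field.
apply: vge_le (_ : N <= N') _; first by rewrite /N'; lia.
apply: vgeB; first apply: vgeN.
  rewrite -[N']add0r vgeM ?big //.
  by rewrite vgeE // vt.
rewrite -[N']addr0 vgeM ?big //.
by apply: vge_le (_ : vge 1 _) => //; apply: vgeD.
Qed.

(** Dividing [a] by the square of a lift of [c] gives an element with residue 1, to which [sqrt_1p]
    applies. *)
Lemma square_of_res a c : vge 0 a -> c != 0 -> res a = c ^+ 2 ->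
  exists b, a = b ^+ 2.
Proof.
move=> a0 c0 ac; have [b b0 bc] := lf_res_surj c.
have [bn0 vb] : b != 0 /\ valu b = 0 by apply: res_unit; rewrite ?bc.
have ib : vge 0 b^-1 by rewrite vgeE ?invr_neq0 // valuV vb.
have rib : res b^-1 = c^-1 by rewrite resV // bc.
have ib2 : vge 0 (b^-1 * b^-1) by apply: vge_mul0.
have ab : vge 0 (a * (b^-1 * b^-1)) by apply: vge_mul0.
have [z z1] : exists z, (1 + z) ^+ 2 = 1 + (a * (b^-1 * b^-1) - 1).
  apply: sqrt_1p; rewrite -res_eq0; last exact: vgeB vge01.
  rewrite (resB ab vge01) (lf_resM a0 ib2) (lf_resM ib ib) rib lf_res1 ac.
  by apply/eqP; field.
exists (b * (1 + z)); rewrite exprMn z1; field.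
exact: bn0.
Qed.

Variable p : nat.
Hypotheses (hp : p \in [pchar (lf_resfield K)]).

(* Otherwise sums of squares are squares; since [- y = (p - 1) y], so is every
   difference [((z + 1) / 2) ^ 2 - ((z - 1) / 2) ^ 2 = z]. *)
Lemma res_nonsquare_sum2 : exists a b : lf_resfield K,
  forall c, a ^+ 2 + b ^+ 2 != c ^+ 2.
Proof.
apply: contrapT => no.
have sumsq a b : exists c : lf_resfield K, a ^+ 2 + b ^+ 2 = c ^+ 2.
  apply: contrapT => nc; apply: no; exists a, b => c.
  by apply/eqP => abc; apply: nc; exists c.
have natsq n (a : lf_resfield K) :
    exists c : lf_resfield K, a ^+ 2 *+ n = c ^+ 2.
  elim: n => [|n [c cn]]; first by exists 0; rewrite mulr0n expr0n.
  by have [d dn] := sumsq a c; exists d; rewrite mulrS cn.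
have p0 : (0 < p)%N by rewrite prime_gt0 // (pcharf_prime hp).
have oppsq (a : lf_resfield K) : exists c : lf_resfield K, - a ^+ 2 = c ^+ 2.
  have [c cp] := natsq p.-1 a; exists c; rewrite -cp; apply/eqP.
  rewrite eq_sym -addr_eq0 -mulrSr prednK // -mulr_natr.
  by rewrite (pcharf0 hp) mulr0.
have allsq (z : lf_resfield K) : exists c : lf_resfield K, z = c ^+ 2.
  have [d dz] := oppsq ((z - 1) / 2); have [c cz] := sumsq ((z + 1) / 2) d.
  by exists c; rewrite -cz -dz; field.
(* squaring would be a bijection, but [1] and [-1] have the same square *)
have [g gK] := choice allsq.
have gf : cancel g (fun x => x ^+ 2) by move=> x; rewrite -gK.
have fg := (bij_can_sym (injF_bij (can_inj gf)) _).2 gf.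
have := fg (-1); rewrite sqrrN (fg 1) => /eqP.
by rewrite -addr_eq0; apply/negP.
Qed.

End LocalField.

(** In the cyclic group of units a nonsquare is an odd power of the generator, so multiplying by it
    corrects an odd exponent of [d]. *)
Lemma finfield_square_classes (F : finFieldType) (c d : F) :
  c != 0 -> d != 0 -> (forall x, c != x ^+ 2) ->
  exists (x : F) (i : bool), d * c ^+ i = x ^+ 2.
Proof.
move=> c0 d0 csq.
have /cyclicP[g gE] := field_unit_group_cyclic [set: {unit F}]%G.
have pow (z : F) : z != 0 -> exists n, z = val g ^+ n.
  rewrite -unitfE => uz; have /cycleP[n zn] : FinRing.unit F uz \in <[g]>%g.
    by rewrite -gE inE.
  by exists n; have := congr1 val zn; rewrite FinRing.val_unitX.
have [m cm] := pow _ c0; have [n dn] := pow _ d0.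
have modd : odd m.
  apply/negPn/negP=> me; have /eqP[] := csq (val g ^+ m./2).
  by rewrite cm -exprM muln2 even_halfK.
exists (val g ^+ (n + odd n * m)./2), (odd n).
rewrite dn cm -exprM -exprD -exprM muln2 mulnC even_halfK //.
by rewrite oddD oddM modd andbT oddb addbb.
Qed.

(** * Unary forms and diagonalisation *)

Section UnaryForms.
Variable k : fieldType.
Hypothesis two_neq0 : (2 : k) != 0.

Definition unary_fun (a : k) (x : k^o) : k := a * x ^+ 2.

Lemma unary_polar a x y : polar (unary_fun a) x y = 2 * a * x * y.
Proof.
rewrite /polar /unary_fun.
have E (z t : k) : a * (z + t) ^+ 2 - a * z ^+ 2 - a * t ^+ 2 = 2 * a * z * t.
  ring.
exact: E.
Qed.

Lemma unary_quadratic a : quadratic (unary_fun a).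
Proof.
split=> [c x|y c x z] /=; first by rewrite /unary_fun /GRing.scale /=; ring.
rewrite !unary_polar.
have E (x' y' z' : k) : 2 * a * (c * x' + z') * y' =
    c * (2 * a * x' * y') + 2 * a * z' * y' by ring.
exact: E.
Qed.

Lemma unary_nondegenerate a : a != 0 -> Defs.nondegenerate (unary_fun a).
Proof.
move=> a0 x /(_ 1) /eqP; rewrite unary_polar mulr1 !mulf_eq0.
by rewrite (negPf two_neq0) (negPf a0) => /eqP.
Qed.

Definition unary a (a0 : a != 0) : qform k^o :=
  QForm (unary_quadratic a) (unary_nondegenerate a0).

Definition ucl a (a0 : a != 0) : witt k := witt_class (unary a0).

Lemma ucl_square a b c (a0 : a != 0) (b0 : b != 0) :
  c != 0 -> a = c ^+ 2 * b -> ucl a0 = ucl b0.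
Proof.
move=> c0 ab; apply: witt_class_iso; exists (fun x : k^o => c * x : k^o).
split=> [d x y||x] /=.
- by rewrite mulrDr; congr (_ + _); rewrite mulrCA.
- by exists ( *%R c^-1) => x; rewrite ?mulKf ?mulVKf.
- by rewrite /unary_fun ab; ring.
Qed.

Lemma ucl_opp a b (a0 : a != 0) (b0 : b != 0) : a = - b -> ucl a0 = - ucl b0.
Proof.
move=> ab; rewrite [RHS](_ : _ = witt_class (Defs.oppq (unary b0))).
  apply: witt_class_iso; exists id; split=> //; first by exists id.
  by move=> x; rewrite /= /oppq_fun /unary_fun ab mulNr.
by rewrite witt_class_oppq.
Qed.

(** Multiplication by [x + i y] on pairs scales the sum of two squares by [x ^+ 2 + y ^+ 2]. *)
Lemma ucl_double a b x y (a0 : a != 0) (b0 : b != 0) : x ^+ 2 + y ^+ 2 != 0 ->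
  b = (x ^+ 2 + y ^+ 2) * a -> ucl b0 + ucl b0 = ucl a0 + ucl a0.
Proof.
move=> xy0 ba; rewrite -!witt_classD; apply: witt_class_iso.
pose f (z : k^o * k^o) : k^o * k^o := (x * z.1 - y * z.2, y * z.1 + x * z.2).
have fl : linear f.
  by move=> c z t; congr pair; rewrite /= /GRing.scale /=; ring.
exists f; split=> //.
- apply: linear_bij => //; apply: linear_inj => // -[z t] [e1 e2].
  have z0 : (x ^+ 2 + y ^+ 2) * z = x * (x * z - y * t) + y * (y * z + x * t).
    ring.
  have t0 : (x ^+ 2 + y ^+ 2) * t = x * (y * z + x * t) - y * (x * z - y * t).
    ring.
  by congr pair; apply: (mulfI xy0); rewrite ?z0 ?t0 e1 e2; ring.
- by move=> [z t]; rewrite /= /osum_fun /= /unary_fun ba; ring.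
Qed.

Lemma witt_class_trivial V (q : qform V) : (forall x, q x = 0) ->
  witt_class q = 0 :> witt k.
Proof.
move=> q0; have x0 (x : V) : x = 0.
  apply: (qf_nondegenerate (q := q)) => y.
  by rewrite /polar !q0; ring.
rewrite [RHS](_ : _ = witt_class (hyperbolic k 0)) //; apply: witt_class_iso.
exists (fun _ => 0); split=> [a x y||x].
- by rewrite scaler0 addr0.
- exists (fun _ => 0) => [x|A]; first by rewrite [RHS]x0.
  by apply/matrixP=> -[].
- by rewrite q0 (quadratic0 (qf_quadratic (hyperbolic k 0))).
Qed.

(** Diagonalisation as an induction principle: the line of a vector with nonzero value splits off,
    and the dimension drops by one. *)
Lemma diagonal_ind (P : witt k -> Prop) : P 0 ->
  (forall a (a0 : a != 0) u, P u -> P (ucl a0 + u)) -> forall u, P u.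
Proof.
move=> P0 PD u; rewrite -[u]witt_class_repr.
move: (qs_dim _) (qs_form _) => n q.
elim: {n}_.+1 {-2}n (ltnSn n) q => // N IHN n nN q.
have [q0|] := pselect (forall x, q x = 0); first by rewrite witt_class_trivial.
move=> nq; have [x qx] : exists x, q x != 0.
  apply: contrapT => nx; apply: nq => x; apply: contrapT => qx.
  by apply: nx; exists x; apply/eqP.
have gl : linear (fun c : k^o => c *: x).
  by move=> a c d; rewrite scalerDl scalerA.
have gq (c : k^o) : q (c *: x) = unary qx c.
  by rewrite (qf_quadratic q).1 /= /unary_fun mulrC.
have [m [s qs]] := osum_split gl gq.
rewrite (witt_class_iso qs) witt_classD; apply/PD/IHN.
have := isometric_dim qs; rewrite dim_prod !dim_mx !mul1n (_ : \dim _ = 1%N).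
  by lia.
by rewrite dimvf.
Qed.

End UnaryForms.

(* Coordinates on the Witt group of the residue field: [x] stands for
   [x.1 <1> + x.2 (<1> - <e>)] with [e] a nonsquare, and [s] tells whether
   [-1] is a nonsquare. *)
Definition half_dim (x : bool * bool) : nat :=
  (if x.1 then 1 else if x.2 then 2 else 0)%N.

(** Addition with carry, since twice the class of <1> is [s] times the second generator: the group
    is cyclic of order 4 if [s] holds, and a Klein group otherwise. *)
Definition half_add (s : bool) (x y : bool * bool) : bool * bool :=
  (x.1 (+) y.1, x.2 (+) y.2 (+) (s && x.1 && y.1)).

Definition half_sub (s : bool) (x y : bool * bool) : bool * bool :=
  (x.1 (+) y.1, x.2 (+) y.2 (+) (s && y.1 && ~~ x.1)).

Lemma half_subK s x y : half_add s (half_sub s x y) y = x.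
Proof. by case: s x y => [] [[] []] [[] []]. Qed.

Lemma half_sub_dim0 s x y : half_dim (half_sub s x y) = 0%N -> x = y.
Proof. by case: s x y => [] [[] []] [[] []]. Qed.

Lemma half_addP (W : zmodType) (a b : W) (s : bool) (x y : bool * bool) :
  b + b = 0 -> a + a = b *+ s ->
  (a *+ x.1 + b *+ x.2) + (a *+ y.1 + b *+ y.2) =
  a *+ (half_add s x y).1 + b *+ (half_add s x y).2.
Proof.
move=> bb aa.
have Db (c d : bool) : b *+ c + b *+ d = b *+ (c (+) d).
  by case: c d => [] []; rewrite /= ?mulr1n ?mulr0n ?addr0 ?add0r.
have Da (c d : bool) : a *+ c + a *+ d = a *+ (c (+) d) + b *+ (s && c && d).
  by case: c d => [] []; rewrite /= ?andbT ?andbF ?mulr1n ?mulr0n ?addr0 ?add0r.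
by rewrite addrACA Da Db -addrA Db [_ (+) (x.2 (+) _)]addbC.
Qed.

Definition model_dim (t : (bool * bool) * (bool * bool)) : nat :=
  (half_dim t.1 + half_dim t.2)%N.

Definition model_sub (s : bool) (t t' : (bool * bool) * (bool * bool)) :=
  (half_sub s t.1 t'.1, half_sub s t.2 t'.2).

(** * Springer's decomposition and the sixteen Witt classes *)

Section WittGroupOfLocalField.
Variables (k : fieldType) (K : local_field k) (p : nat).
Hypotheses (hp : p \in [pchar (lf_resfield K)]) (hp2 : p != 2%N).
Local Notation res := (lf_res K).
Local Notation vge := (vge K).
Local Notation valu := (valu K).

Lemma res2_neq0 : (2 : lf_resfield K) != 0.
Proof.
apply: contra hp2 => r2; have : 2%N \in [pchar (lf_resfield K)] by apply/andP.
by rewrite (pcharf_eq hp) inE eq_sym.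
Qed.

Let two0 : (2 : k) != 0 := (two_unit res2_neq0).1.

(** Making the unit a sum of two squares in [k] itself lets [ucl_double] apply, so that <1> and <e>
    have the same double. *)
Lemma nonsquare_unit_exists : exists e : k, [/\ e != 0, valu e = 0,
  forall c, res e != c ^+ 2 & exists x y, e = x ^+ 2 + y ^+ 2].
Proof.
have [a [b abc]] := res_nonsquare_sum2 res2_neq0 hp.
have [x x0 xa] := lf_res_surj a; have [y y0 yb] := lf_res_surj b.
have re : res (x ^+ 2 + y ^+ 2) = a ^+ 2 + b ^+ 2.
  rewrite !expr2 (@lf_resD _ K) ?(@lf_resM _ K) ?xa ?yb //; exact: vge_mul0.
have [e0 ve] : x ^+ 2 + y ^+ 2 != 0 /\ valu (x ^+ 2 + y ^+ 2) = 0.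
  apply: res_unit; first by apply: vgeD; rewrite expr2; apply: vge_mul0.
  by rewrite re; have := abc 0; rewrite expr0n.
exists (x ^+ 2 + y ^+ 2); split=> //; last by exists x, y.
by move=> c; rewrite re.
Qed.

Variable e : k.
Hypotheses (e0 : e != 0) (ve : valu e = 0) (esq : forall c, res e != c ^+ 2).
Hypothesis (esum : exists x y, e = x ^+ 2 + y ^+ 2).

Lemma unit_square_classes a : a != 0 -> valu a = 0 ->
  exists (b : k) (i : bool), b != 0 /\ a = b ^+ 2 * e ^+ i.
Proof.
move=> a0 va; have [ia ra] := unit_res a0 va; have [ie re] := unit_res e0 ve.
have [c [i ac]] := finfield_square_classes re ra esq.
have iei : vge 0 (e ^+ i) by case: i {ac}; rewrite ?expr1 ?expr0 ?vge01.
have rei : res (e ^+ i) = res e ^+ i.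
  by case: i {ac iei}; rewrite ?expr1 ?expr0 ?lf_res1.
have c0 : c != 0.
  by have := mulf_neq0 ra (expf_neq0 i re); rewrite ac expf_eq0.
have [b ab] : exists b, a * e ^+ i = b ^+ 2.
  apply: (square_of_res res2_neq0 (vge_mul0 ia iei) c0).
  by rewrite lf_resM // rei.
have b0 : b != 0 by have := mulf_neq0 a0 (expf_neq0 i e0); rewrite ab expf_eq0.
exists (b / e ^+ i), i; split; first by rewrite mulf_neq0 ?invr_eq0 ?expf_neq0.
by apply: (mulIf (expf_neq0 i e0)); rewrite ab; field; rewrite expf_neq0.
Qed.

Definition vodd (x : k) : bool := odd (absz (valu x)).

Lemma vodd_mul x y : x != 0 -> y != 0 -> vodd (x * y) = vodd x (+) vodd y.
Proof. by move=> x0 y0; rewrite /vodd valuM //; lia. Qed.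

Lemma vodd_square x : vodd (x ^+ 2) = false.
Proof.
(* At 0 the default value of [valu] is even. *)
have [->|x0] := eqVneq x 0; first rewrite expr0n /= /vodd /valu.
  by have := lf_val_pinfty K 0; rewrite eqxx => /eqP ->.
by rewrite expr2 vodd_mul // addbb.
Qed.

(** Factor out the square of the coordinate of least valuation. The other factor is a unit, because
    the residue of [e] is not a square. *)
Lemma norm_form_val x y : (x != 0) || (y != 0) ->
  x ^+ 2 - e * y ^+ 2 != 0 /\ vodd (x ^+ 2 - e * y ^+ 2) = false.
Proof.
have [ie re] := unit_res e0 ve.
have main z t : z != 0 -> vge 0 (t / z) ->
    (z ^+ 2 - e * t ^+ 2 != 0 /\ vodd (z ^+ 2 - e * t ^+ 2) = false) /\
    (t ^+ 2 - e * z ^+ 2 != 0 /\ vodd (t ^+ 2 - e * z ^+ 2) = false).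
  move=> z0 it; set s := t / z in it; have z20 := expf_neq0 2 z0.
  have ts : t = z * s by rewrite /s mulrC divfK.
  have iss : vge 0 (s * s) by apply: vge_mul0.
  have iess : vge 0 (e * (s * s)) by apply: vge_mul0.
  have conc w : w != 0 /\ valu w = 0 ->
      z ^+ 2 * w != 0 /\ vodd (z ^+ 2 * w) = false.
    case=> w0 vw; rewrite mulf_neq0 // vodd_mul // vodd_square.
    by rewrite /vodd vw.
  have -> : z ^+ 2 - e * t ^+ 2 = z ^+ 2 * (1 - e * (s * s)) by rewrite ts; ring.
  have -> : t ^+ 2 - e * z ^+ 2 = z ^+ 2 * (s * s - e) by rewrite ts; ring.
  split; apply/conc/res_unit.
  - exact: vgeB (vge01 K) _.
  - rewrite resB ?vge01 // lf_res1 (lf_resM ie iss) (lf_resM it it) subr_eq0.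
    (* Otherwise the residue of [e] would be the square of the inverse of [res s]. *)
    apply/eqP=> E; have rs0 : res s != 0.
      by apply: contra_eq_neq E => ->; rewrite mulr0 mulr0 oner_neq0.
    have /eqP[] := esq (res s)^-1.
    by apply: (mulIf (mulf_neq0 rs0 rs0)); rewrite -E; field.
  - exact: vgeB.
  - rewrite resB // (lf_resM it it) subr_eq0 eq_sym -expr2; exact: esq.
have [->|x0] := eqVneq x 0.
  by move=> /= y0; apply: (main y 0 y0 _).2; rewrite mul0r vge0.
have [->|y0] := eqVneq y 0.
  by move=> _; apply: (main x 0 x0 _).1; rewrite mul0r vge0.
have vge_div z t : z != 0 -> t != 0 -> valu z <= valu t -> vge 0 (t / z).
  move=> z0 t0 zt; rewrite vgeE ?mulf_neq0 ?invr_neq0 //.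
  by rewrite valuM ?invr_neq0 // valuV; lia.
move=> _; have [vxy|/ltW vyx] := leP (valu x) (valu y).
  by apply: (main x y x0 _).1; apply: vge_div.
by apply: (main y x y0 _).2; apply: vge_div.
Qed.

(* Anisotropic and of constant valuation parity, as are the two summands of
   Springer's decomposition. *)
Definition parity_rep (b : bool) (n : nat) (u : witt k) : Prop :=
  exists (V : vectType k) (q : qform V), [/\ \dim {:V} = n, witt_class q = u &
    forall x, x != 0 -> q x != 0 /\ vodd (q x) = b].

(** Nonzero values of the two summands have valuations of opposite parity, so they cannot cancel. *)
Lemma anisotropic_dim_springer n m u w :
  parity_rep false n u -> parity_rep true m w ->
  anisotropic_dim (u + w) = (n + m)%N.
Proof.
move=> [V [q [<- <- qP]]] [W [r [<- <- rP]]].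
rewrite -witt_classD anisotropic_dim_class ?dim_prod // => -[x y].
rewrite /= /osum_fun /= => E.
have [x0|x0] := eqVneq x 0; have [y0|y0] := eqVneq y 0.
- by rewrite x0 y0.
- have [+ _] := rP _ y0; move: E; rewrite x0 (quadratic0 (qf_quadratic q)).
  by rewrite add0r => ->; rewrite eqxx.
- have [+ _] := qP _ x0; move: E; rewrite y0 (quadratic0 (qf_quadratic r)).
  by rewrite addr0 => ->; rewrite eqxx.
- have [_ vx] := qP _ x0; have [_ vy] := rP _ y0.
  move/eqP: E; rewrite addr_eq0 => /eqP E.
  by move: vx; rewrite E /vodd valuN; move: vy; rewrite /vodd => ->.
Qed.

(** The class with coordinates [x], scaled by [a]; [a = 1] and [a] a uniformizer give the two
    Springer components. *)
Definition half_class a (a0 : a != 0) (x : bool * bool) : witt k :=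
  ucl two0 a0 *+ x.1 + (ucl two0 a0 - ucl two0 (mulf_neq0 e0 a0)) *+ x.2.

Section HalfClass.
Variables (a : k) (a0 : a != 0).
Let x := ucl two0 a0.
Let y := ucl two0 (mulf_neq0 e0 a0).

Lemma half_double : x + x = y + y.
Proof.
have [z [t et]] := esum; apply/esym/(ucl_double two0 (x := z) (y := t)).
  by rewrite -et.
by rewrite -et.
Qed.

Lemma half_parity_rep z : parity_rep (vodd a) (half_dim z) (half_class a0 z).
Proof.
have un b (b0 : b != 0) : vodd b = vodd a -> parity_rep (vodd a) 1 (ucl two0 b0).
  move=> vb; exists k^o, (unary two0 b0); split=> //; first by rewrite dimvf.
  move=> t t0; rewrite /= /unary_fun mulf_neq0 ?expf_neq0 //.
  by rewrite vodd_mul ?expf_neq0 // vodd_square addbF.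
case: z => [[] []]; rewrite /half_class /half_dim /= ?mulr1n ?mulr0n ?add0r ?addr0.
(* Here [x + (x - y) = y] because [x + x = y + y], so the class is again unary. *)
- rewrite -/x -/y addrA half_double addrK; apply: un.
  by rewrite vodd_mul // /vodd ve.
- exact: un.
- exists (k^o * k^o)%type,
    (osum (unary two0 a0) (Defs.oppq (unary two0 (mulf_neq0 e0 a0)))); split.
  + by rewrite dimvf.
  + by rewrite witt_classD witt_class_oppq.
  move=> [z t] zt; rewrite /= /osum_fun /= /oppq_fun /unary_fun.
  have -> : a * z ^+ 2 + - (e * a * t ^+ 2) = a * (z ^+ 2 - e * t ^+ 2) by ring.
  have [|n0 vn] := @norm_form_val z t.
    by apply: contraNT zt; rewrite negb_or !negbK => /andP[/eqP -> /eqP ->].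
  by rewrite mulf_neq0 // vodd_mul // vn addbF.
- exists 'M[k]_(0, 2), (hyperbolic k 0); split=> //; first by rewrite dim_mx.
  by move=> A; case/negP; apply/eqP/matrixP=> -[].
Qed.

End HalfClass.

(** Write -1 as a square times a power of [e]. Then the opposite of <a> is <a> or <ea>, according to
    an exponent that does not depend on [a]. *)
Lemma minus1_class : exists s : bool, forall a (a0 : a != 0),
  ucl two0 a0 + ucl two0 a0 =
  (ucl two0 a0 - ucl two0 (mulf_neq0 e0 a0)) *+ s.
Proof.
have n1 : -1 != 0 :> k by rewrite oppr_eq0 oner_neq0.
have [|b [i [b0 bi]]] := unit_square_classes n1; first by rewrite valuN valu1.
exists i => a a0; have na : - a != 0 by rewrite oppr_eq0.
have nx : - ucl two0 a0 = ucl two0 na by rewrite (ucl_opp two0 na a0 erefl).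
case: i bi => /= bi.
- rewrite mulr1n -(@ucl_square _ two0 (- a) (e * a) b na) //; last first.
    by rewrite -mulN1r bi; ring.
  by rewrite -nx opprK.
- rewrite mulr0n -[X in X + _]opprK nx.
  rewrite (@ucl_square _ two0 (- a) a b na a0) ?addNr //.
  by rewrite -mulN1r bi; ring.
Qed.

Lemma square_classes c a : c != 0 -> valu c = 1 -> a != 0 ->
  exists (b : k) (i j : bool), b != 0 /\ a = b ^+ 2 * (e ^+ i * c ^+ j).
Proof.
(* Half the valuation, rounded down, goes into [b] and its parity into [c]; what remains of [a] is a
   unit. *)
move=> c0 vc a0; have [b b0 vb] := valu_surj K (valu a %/ 2)%Z.
have cj := expf_neq0 (vodd a) c0; have b20 := expf_neq0 2 b0.
have bc0 : b ^+ 2 * c ^+ vodd a != 0 by rewrite mulf_neq0.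
have ab0 : a / (b ^+ 2 * c ^+ vodd a) != 0 by rewrite mulf_neq0 ?invr_eq0.
have [|d [i [d0 di]]] := unit_square_classes ab0.
  rewrite valuM ?invr_eq0 // valuV valuM // expr2 valuM // vb.
  have -> : valu (c ^+ vodd a) = vodd a :> int.
    by case: (vodd a); rewrite ?valu1 ?expr1.
  by rewrite /vodd; lia.
exists (b * d), i, (vodd a); split; first by rewrite mulf_neq0.
by rewrite -[LHS](divfK bc0) di; ring.
Qed.

End WittGroupOfLocalField.

(** The law is given for differences because the count fixes one class and subtracts it from the
    target. *)
Lemma witt_group_model (k : fieldType) (K : local_field k) (p : nat) :
  p \in [pchar (lf_resfield K)] -> p != 2%N ->
  exists (w : (bool * bool) * (bool * bool) -> witt k) (s : bool),
  [/\ injective w, forall u, exists t, w t = u,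
      forall t t', w t - w t' = w (model_sub s t t') &
      forall t, anisotropic_dim (w t) = model_dim t].
Proof.
move=> hp hp2; have [e [e0 ve esq esum]] := nonsquare_unit_exists hp hp2.
have [c c0 vc] := valu_surj K 1.
have [s sP] := minus1_class hp hp2 e0 ve esq.
pose hc a (a0 : a != 0) := half_class hp hp2 e0 a0.
have hcD a (a0 : a != 0) x y : hc a a0 x + hc a a0 y = hc a a0 (half_add s x y).
  apply: half_addP; last exact: sP.
  by rewrite addrACA -opprD -(half_double hp hp2 e0 esum) subrr.
pose w t := hc 1 (oner_neq0 k) t.1 + hc c c0 t.2.
have wB t t' : w t - w t' = w (model_sub s t t').
  apply/eqP; rewrite subr_eq /w [X in _ == X]addrACA !hcD /model_sub /= !half_subK.
  exact: eqxx.
have wdim t : anisotropic_dim (w t) = model_dim t.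
  apply: (@anisotropic_dim_springer _ K).
    have := half_parity_rep hp hp2 e0 ve esq esum (oner_neq0 k) t.1.
    by rewrite /vodd valu1.
  have := half_parity_rep hp hp2 e0 ve esq esum c0 t.2.
  by rewrite /vodd vc.
have w0 : w ((false, false), (false, false)) = 0.
  by rewrite /w /hc /half_class /= !mulr0n !addr0.
exists w, s; split=> //.
(* Equal classes have a difference of anisotropic dimension 0, which only equal coordinates
   allow. *)
- move=> t t' /eqP; rewrite -subr_eq0 wB => /eqP wtt'.
  have : model_dim (model_sub s t t') = 0%N.
    by rewrite -wdim wtt' -w0 wdim.
  move/eqP; rewrite addn_eq0 => /andP[/eqP/half_sub_dim0 t1 /eqP/half_sub_dim0 t2].
  by rewrite [t]surjective_pairing [t']surjective_pairing t1 t2.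
- apply: (@diagonal_ind _ (two_unit (res2_neq0 hp hp2)).1
    (fun u => exists t, w t = u)).
    by exists ((false, false), (false, false)).
  move=> a a0 u [t <-].
  have [b [i [j [b0 ab]]]] := square_classes hp hp2 e0 ve esq c0 vc a0.
  have [t' <-] : exists t', w t' = ucl (two_unit (res2_neq0 hp hp2)).1 a0.
    have hc10 d (d0 : d != 0) : hc d d0 (true, false) =
        ucl (two_unit (res2_neq0 hp hp2)).1 d0.
      by rewrite /hc /half_class /= mulr1n mulr0n addr0.
    have hc11 d (d0 : d != 0) : hc d d0 (true, true) =
        ucl (two_unit (res2_neq0 hp hp2)).1 (mulf_neq0 e0 d0).
      rewrite /hc /half_class /= !mulr1n addrA.
      by rewrite (half_double hp hp2 e0 esum) addrK.
    have hc00 d (d0 : d != 0) : hc d d0 (false, false) = 0.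
      by rewrite /hc /half_class /= !mulr0n addr0.
    (* The exponent of [c] selects the Springer component; that of [e] distinguishes [(true, false)]
       from [(true, true)]. *)
    case: i j ab => [] [] /= ab.
    - exists ((false, false), (true, true)); rewrite /w hc00 add0r hc11.
      by apply/esym/(@ucl_square _ _ _ _ b).
    - exists ((true, true), (false, false)); rewrite /w hc00 addr0 hc11.
      by apply/esym/(@ucl_square _ _ _ _ b).
    - exists ((false, false), (true, false)); rewrite /w hc00 add0r hc10.
      by apply/esym/(@ucl_square _ _ _ _ b); rewrite // ab mul1r.
    - exists ((true, false), (false, false)); rewrite /w hc00 addr0 hc10.
      by apply/esym/(@ucl_square _ _ _ _ b); rewrite // ab mul1r.
  exists (half_add s t'.1 t.1, half_add s t'.2 t.2).
  by rewrite /w [RHS]addrACA !hcD.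
Qed.

(** * Convolutions on the finite model and the closed form *)

Definition model_elems : seq ((bool * bool) * (bool * bool)) :=
  let b := [:: false; true] in
  let h := [seq (u, v) | u <- b, v <- b] in
  [seq (x, y) | x <- h, y <- h].

Lemma mem_model_elems t : t \in model_elems.
Proof. by case: t => [[[] []] [[] []]]. Qed.

Lemma uniq_model_elems : uniq model_elems.
Proof. by []. Qed.

(* The sum of [g (anisotropic_dim (u - v))] over the [v] realised in dimension
   [i], where [n = anisotropic_dim u]. *)
Definition convolve_dim (R : comNzRingType) (i : nat) (g : nat -> R)
    (n : nat) : R :=
  if i == 1%N then
    nth 0 [:: 4 * g 1%N; g 0%N + 3 * g 2%N; 2 * g 1%N + 2 * g 3%N;
              3 * g 2%N + g 4%N; 4 * g 3%N] n
  else if i == 2%N then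
    nth 0 [:: g 0%N + 6 * g 2%N; 4 * g 1%N + 3 * g 3%N;
              g 0%N + 5 * g 2%N + g 4%N; 3 * g 1%N + 4 * g 3%N; 6 * g 2%N + g 4%N] n
  else if odd n == odd i then g 0%N + 6 * g 2%N + g 4%N
  else 4 * g 1%N + 4 * g 3%N.

(** Direct verification for both values of [s] and all sixteen [t]: the result sees [t] only through
    its dimension. *)
Lemma sum_model_sub_small (R : comNzRingType) s t i (g : nat -> R) :
  i \in [:: 1; 2]%N ->
  \sum_(t' <- model_elems | admissible i (model_dim t'))
    g (model_dim (model_sub s t t')) = convolve_dim i g (model_dim t).
Proof.
rewrite !inE => /orP[] /eqP ->; rewrite big_mkcond /=.
all: case: s t => [] [[[] []] [[] []]]; rewrite !big_cons big_nil.
all: rewrite /convolve_dim /model_dim /model_sub /half_dim /half_sub /=.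
all: by rewrite -?plusE /= ?(add0r, addr0); ring.
Qed.

Lemma sum_model_sub_large (R : comNzRingType) s t (b : bool) (g : nat -> R) :
  \sum_(t' <- model_elems | odd (model_dim t') == b)
    g (model_dim (model_sub s t t')) =
  if odd (model_dim t) == b then g 0%N + 6 * g 2%N + g 4%N
  else 4 * g 1%N + 4 * g 3%N.
Proof.
rewrite big_mkcond /=.
case: b; case: s t => [] [[[] []] [[] []]]; rewrite !big_cons big_nil.
all: rewrite /model_dim /model_sub /half_dim /half_sub /=.
all: by rewrite -?plusE /= ?(add0r, addr0); ring.
Qed.

Lemma sum_model_sub (R : comNzRingType) s t i (g : nat -> R) : (0 < i)%N ->
  \sum_(t' <- model_elems | admissible i (model_dim t'))
    g (model_dim (model_sub s t t')) = convolve_dim i g (model_dim t).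
Proof.
move=> i0; have [i2|i3] := leqP i 2.
  by apply: sum_model_sub_small; rewrite !inE; lia.
have [/negPf n1 /negPf n2] : i != 1%N /\ i != 2%N by lia.
rewrite /convolve_dim n1 n2 -(sum_model_sub_large s); apply: eq_bigl => t'.
have : (model_dim t' <= 4)%N by case: t' => [[[] []] [[] []]].
rewrite /admissible; move: (model_dim t') => d d4.
(* Once [i] is at least 3, only parity matters: the bound fails only for [d = 4] and [i = 3], which
   parity already excludes. *)
by have [//|id_] := leqP d i; have [-> ->] : d = 4%N /\ i = 3%N by lia.
Qed.

Lemma odd_model_sub s t t' :
  odd (model_dim (model_sub s t t')) = odd (model_dim t) (+) odd (model_dim t').
Proof.
have oh x : odd (half_dim x) = x.1 by case: x => [[] []].
by rewrite /model_dim !oddD !oh /= addbACA.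
Qed.

(* The number of solutions splits as an average over the parity class plus a
   term supported on lists without part [>= 3]. *)
Definition count_formula (R : numFieldType) (c1 c2 c3 n : nat) : R :=
  8^-1 * 4 ^+ c1 * 7 ^+ c2 * 8 ^+ c3 +
  if (0 < c3)%N then 0
  else if (0 < c1)%N then (2 - n%:R) * (2 ^+ c1 / 4)
  else (-1) ^+ odd c2 * ((n == if odd c2 then 4 else 0)%N%:R - 8^-1).

(** When all earlier parts are 2, the closed form is the count only at even dimensions; the parity
    premise ensures that the convolution evaluates it only there. *)
Lemma count_formula_step (R : numFieldType) c1 c2 c3 n i : (0 < i)%N ->
  (n <= 4)%N -> ((c1 == 0)%N && (c3 == 0)%N ==> (odd n == odd i)) ->
  count_formula R ((i == 1)%N + c1) ((i == 2)%N + c2) ((2 < i)%N + c3) n =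
  convolve_dim i (count_formula R c1 c2 c3) n.
Proof.
rewrite /count_formula /convolve_dim !oddD.
have [->|i1] := eqVneq i 1%N.
  move=> _ n4 par; rewrite /= !add0n !add1n !exprS.
  case: c3 par => [|c3] par /=; last first.
    by case: n n4 {par} => [|[|[|[|[|//]]]]] _ /=; field.
  case: c1 par => [|c1] /= par; last first.
    by case: n n4 {par} => [|[|[|[|[|//]]]]] _ /=; rewrite ?exprS; field.
  by case: (odd c2); case: n n4 par => [|[|[|[|[|//]]]]] _ //= _;
    rewrite ?expr0 ?expr1 /=; field.
have [->|i2] := eqVneq i 2%N.
  move=> _ n4 par; rewrite /= !add0n !add1n !exprS.
  case: c3 par => [|c3] par /=; last first.
    by case: n n4 {par} => [|[|[|[|[|//]]]]] _ /=; field.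
  case: c1 par => [|c1] /= par; last first.
    by case: n n4 {par} => [|[|[|[|[|//]]]]] _ /=; field.
  by case: (odd c2); case: n n4 par => [|[|[|[|[|//]]]]] _ //= _;
    rewrite ?expr0 ?expr1 /=; field.
move=> i0 n4 par; have -> : (2 < i)%N by lia.
rewrite /= !add0n !add1n !exprS.
case: c3 par => [|c3] par /=; last by case: ifP => _; field.
case: c1 par => [|c1] /= par; first rewrite par.
  by case: (odd c2); rewrite ?expr0 ?expr1 /=; field.
by case: ifP => _; field.
Qed.

(** * Enumeration of the tuples of Witt classes with a given sum *)

Section Counting.
Variable k : fieldType.
Local Notation T := ((bool * bool) * (bool * bool))%type.
Variables (w : T -> witt k) (s : bool).
Hypotheses (w_inj : injective w) (w_surj : forall u, exists t, w t = u).
Hypothesis wB : forall t t', w t - w t' = w (model_sub s t t').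
Hypothesis w_dim : forall t, anisotropic_dim (w t) = model_dim t.

Definition represented (i : nat) : seq (witt k) :=
  [seq u <- map w model_elems | admissible i (anisotropic_dim u)].

Lemma mem_represented i u :
  (u \in represented i) = admissible i (anisotropic_dim u).
Proof.
rewrite mem_filter; have [t <-] := w_surj u.
by rewrite map_f ?andbT // mem_model_elems.
Qed.

Lemma uniq_represented i : uniq (represented i).
Proof. by rewrite filter_uniq // map_inj_uniq // uniq_model_elems. Qed.

(** Choosing the first class [v] leaves the target [u - v], which makes the count satisfy the
    convolution recursion. *)
Fixpoint witt_solutions (l : seq nat) (u : witt k) : seq (seq (witt k)) :=
  if l is i :: l' then
    [seq v :: r | v <- represented i, r <- witt_solutions l' (u - v)]
  else if u == 0 then [:: [::]] else [::].

Lemma mem_witt_solutions l u r : (r \in witt_solutions l u) =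
  all2 (fun v i => admissible i (anisotropic_dim v)) r l &&
  (\sum_(v <- r) v == u).
Proof.
elim: l u r => [|i l IHl] u r /=.
  case: r => [|v r]; rewrite /= ?big_nil.
    by rewrite eq_sym; case: eqP; rewrite ?inE ?eqxx.
  by case: eqP.
apply/allpairsPdep/idP => [[v [r' [vi r'l ->]]]|].
  move: r'l; rewrite IHl /= big_cons => /andP[-> /eqP ->].
  by rewrite -mem_represented vi addrC subrK eqxx.
case: r => [//|v r] /=; rewrite big_cons -mem_represented.
move=> /andP[/andP[vi rl] /eqP vr]; exists v, r; split=> //.
by rewrite IHl rl /= -vr addrC addKr.
Qed.

Lemma uniq_witt_solutions l u : uniq (witt_solutions l u).
Proof.
elim: l u => [|i l IHl] u /=; first by case: eqP.
apply: allpairs_uniq_dep; first exact: uniq_represented.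
  by move=> v _; apply: IHl.
by move=> [v r] [v' r'] _ _ /= [-> ->].
Qed.

(** Supplies the parity premise of [count_formula_step]. *)
Lemma odd_sumn_twos l : all (fun i => 0 < i)%N l ->
  count (pred1 1%N) l = 0%N -> count (fun i => 2 < i)%N l = 0%N ->
  ~~ odd (sumn l).
Proof.
elim: l => //= i l IHl /andP[i0 l0]; case: (i =P 1%N) => //= i1.
case: (ltnP 2 i) => //= i2 c1 c3; have -> : i = 2%N by lia.
by rewrite oddD; apply: IHl.
Qed.

(** The parity condition passes to every [u - v] with [v] represented, so the induction hypothesis
    reduces each step to a convolution on the model. *)
Lemma size_witt_solutions (R : numFieldType) l u :
  all (fun i => 0 < i)%N l -> odd (anisotropic_dim u) = odd (sumn l) ->
  (size (witt_solutions l u))%:R = count_formula R (count (pred1 1%N) l)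
    (count (pred1 2%N) l) (count (fun i => 2 < i)%N l) (anisotropic_dim u).
Proof.
elim: l u => [|i l IHl] u.
  move=> _; have [t <-] := w_surj u; rewrite w_dim => par.
  have w0 : w ((false, false), (false, false)) = 0.
    by have := wB t t; rewrite subrr; case: s t {par} => [] [[[] []] [[] []]].
  rewrite /= -w0 (inj_eq w_inj) /count_formula /=.
  by case: t par => [[[] []] [[] []]] //= _; field.
move=> /= /andP[i0 l0]; rewrite oddD => par; rewrite size_allpairs_dep sumnE.
rewrite big_map natr_sum /represented big_filter big_map.
have [t tu] := w_surj u; rewrite -tu w_dim.
rewrite -tu w_dim in par.
transitivity (\sum_(t' <- model_elems | admissible i (model_dim t'))
    count_formula R (count (pred1 1%N) l) (count (pred1 2%N) l)
      (count (fun i => 2 < i)%N l) (model_dim (model_sub s t t'))).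
  apply: eq_big => t'; first by rewrite w_dim.
  rewrite w_dim => /andP[_ /eqP oddt']; rewrite IHl ?wB ?w_dim //.
  by rewrite odd_model_sub par oddt' addbAC addbb.
rewrite sum_model_sub // count_formula_step //.
  by case: t {tu par} => [[[] []] [[] []]].
apply/implyP => /andP[/eqP c1 /eqP c3].
by rewrite par (negPf (odd_sumn_twos l0 c1 c3)) addbF.
Qed.

End Counting.

(** * From the closed form to the stated formula, and from lists to assignments *)

Lemma T_formula_count n0 c1 c2 c3 :
  T_formula n0 c1 c2 c3 = count_formula rat c1 c2 c3 n0.
Proof.
rewrite /T_formula /count_formula; case: ifP => [|/negbT].
  by rewrite addr0.
rewrite -eqn0Ngt => /eqP ->; rewrite expr0 mulr1; case: ifP => [_|/negbT].
  by rewrite expfzDr // -exprnP.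
rewrite -eqn0Ngt => /eqP ->; rewrite expr0 mulr1.
(* Since 7 is -1 modulo 8, the quotient lies at distance 1/8 from [q]; that error cancels the term
   [8^-1] of the closed form. *)
have [q qE] : exists q : int, (7 ^+ c2 : rat) = 8 * q%:~R + (-1) ^+ odd c2.
  elim: c2 => [|c [q IHq]]; first by exists 0; rewrite expr0 mulr0 add0r.
  exists (7 * q + (-1) ^+ odd c); rewrite exprS IHq rmorphD rmorphM /=.
  by case: (odd c); rewrite /= ?expr0 ?expr1 ?rmorphN /=; ring.
have -> : nearest_int (8^-1 * 7 ^+ c2) = q.
  apply: floor_def; rewrite qE intrD.
  by case: (odd c2); rewrite ?expr0 ?expr1; lra.
rewrite qE rmorphD /= /epsilon -signr_odd.
case: (odd c2) => /=; rewrite ?andbT ?andbF ?orbF /=.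
  by case: eqP => _ /=; rewrite ?expr1 ?rmorphN /=; field.
by case: eqP => _ /=; rewrite ?expr0 /=; field.
Qed.

Lemma map_nth_index (S : eqType) (W : Type) (x0 : W) (s : seq S) r :
  uniq s -> size r = size s -> [seq nth x0 r (index a s) | a <- s] = r.
Proof.
move=> us sr; apply: (@eq_from_nth _ x0); rewrite size_map // => i.
case: s us sr => [|a s] us sr // ilt.
by rewrite (nth_map a) // index_uniq.
Qed.

Lemma all2_mapP (S : eqType) (W U : Type) (x0 : W) (P : W -> U -> bool)
    (f : S -> U) (s : seq S) r : uniq s ->
  all2 P r (map f s) <->
  size r = size s /\ forall a, a \in s -> P (nth x0 r (index a s)) (f a).
Proof.
elim: s r => [|b s IHs] [|v r] //=; first by split=> // -[].
  by split=> // -[].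
move=> /andP[bs us]; split.
  move=> /andP[vb /(IHs _ us)[-> Ps]]; split=> // a; rewrite inE eq_sym.
  by case: eqP => [<-//|_] /= /Ps.
move=> [[sr] Ps]; apply/andP; split.
  by have := Ps b; rewrite inE eqxx; apply.
apply/(IHs _ us); split=> // a as_; have := Ps a.
rewrite inE as_ orbT; case: eqP => [ba|_]; last exact.
by move: bs; rewrite ba as_.
Qed.

Lemma card_mem_seq (S : eqType) (r : seq S) : uniq r ->
  ([set x | x \in r] #= `I_(size r))%card.
Proof.
case: r => [|x0 r] ur.
  by rewrite II0 card_eq0; apply/eqP/seteqP; split.
rewrite [X in (X #= _)%card]
  (_ : _ = nth x0 (x0 :: r) @` `I_(size (x0 :: r)))%classic.
  apply: inj_card_eq => i j; rewrite !inE /= => il jl /eqP.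
  by rewrite nth_uniq // => /eqP.
apply/seteqP; split=> [x /= /(nthP x0)[i il <-]|_ [i il <-]]; first by exists i.
exact: mem_nth.
Qed.

Lemma chi_count (k : fieldType) (V : vectType k) (A : finType)
    (M : A -> {vspace V}) i :
  chi M i = count (pred1 i) [seq \dim (M a) | a <- enum A].
Proof.
rewrite /chi -sum1_card count_map -sum1_count big_enum_cond /=.
by apply: eq_bigl => a; rewrite !inE.
Qed.

(** With [m = 3] this evaluates [chi3p]: every dimension lies below the upper bound of the sum. *)
Lemma sum_count_pred1 (m n : nat) l : all (fun i => i < n)%N l ->
  (\sum_(m <= i < n) count (pred1 i) l)%N = count (leq m) l.
Proof.
elim: l => [|x l IHl] /=; first by rewrite big1.
move=> /andP[xn /IHl <-]; rewrite big_split /=; congr addn.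
rewrite (eq_bigr (fun i => if pred1 x i then 1 else 0)%N); last first.
  by move=> i _ /=; rewrite eq_sym; case: (i == x).
rewrite -big_mkcond sum1_count count_uniq_mem ?iota_uniq // mem_index_iota xn.
by rewrite andbT.
Qed.

Theorem theorem4p3 (k : fieldType) (K : local_field k) (p : nat)
    (hp : p \in [pchar (lf_resfield K)]) (hp2 : p != 2%N)
    (V : vectType k) (n : nat) (hn : (1 <= n)%N) (hdim : \dim {:V} = n)
    (A : finType) (M : A -> {vspace V})
    (hM0 : forall a, M a != 0%VS)
    (hMdirect : directv (\sum_(a : A) M a))
    (hMsum : (\sum_(a : A) M a)%VS = fullv)
    (u : witt k) (n0 : nat) (hn0 : n0 = anisotropic_dim u)
    (hle : (n0 <= n)%N) (heven : ~~ odd (n - n0)) :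
  exists T : nat,
    (assignments M u #= `I_T)%card /\
    T%:R = T_formula n0 (chi M 1) (chi M 2) (chi3p M).
Proof.
have [w [s [w_inj w_surj wB w_dim]]] := witt_group_model hp hp2.
pose dims := [seq \dim (M a) | a <- enum A].
have dims_gt0 : all (fun i => 0 < i)%N dims.
  by apply/allP=> _ /mapP[a _ ->]; rewrite lt0n dimv_eq0.
(* Directness makes the dimensions add up to [n], so [heven] becomes the parity condition of the
   count. *)
have sum_dims : sumn dims = n.
  rewrite sumnE big_map big_enum /= -hdim -hMsum.
  by have := hMdirect; rewrite directvE /= => /eqP.
exists (size (witt_solutions w dims u)); split; last first.
  rewrite (size_witt_solutions w_inj w_surj wB w_dim) //; last first.
    by rewrite sum_dims -hn0; move: heven; rewrite oddB // negb_add => /eqP.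
  rewrite T_formula_count !chi_count -hn0 /chi3p.
  rewrite (eq_bigr (fun i => count (pred1 i) dims)) ; last first.
    by move=> i _; apply: chi_count.
  rewrite sum_count_pred1 //; apply/allP=> _ /mapP[a _ ->].
  exact/dimvS/subvf.
(* Reading off Witt classes along [enum A] is injective by cancellation, and its image is exactly
   the enumerated solutions. *)
pose F (c : forall a, isometry_class (subvs_of (M a))) :=
  [seq witt_of_isometry_class (c a) | a <- enum A].
have F_inj : injective F.
  move=> c d /eq_in_map cd; apply: functional_extensionality_dep => a.
  by apply/witt_of_isometry_class_inj/cd; rewrite mem_enum.
have F_im : (F @` assignments M u =
    [set r | r \in witt_solutions w dims u])%classic.
  have enumU : uniq (enum A) by apply: enum_uniq.
  apply/seteqP; split=> [_ [c <- <-]|r] /=; rewrite mem_witt_solutions //.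
    apply/andP; split; last by rewrite big_map big_enum.
    apply/(all2_mapP 0) => //; split=> [|a aA]; first by rewrite size_map.
    rewrite (nth_map a) ?index_mem // nth_index // -dim_subvs.
    by apply/witt_of_isometry_class_image; exists (c a).
  move=> /andP[/(all2_mapP 0 _ _ _ enumU)[size_r adm] /eqP sum_r].
  (* Each admissible entry is realised on its subspace; choosing such a class for every [a] inverts
     [F]. *)
  have ex a : exists c : isometry_class (subvs_of (M a)),
      witt_of_isometry_class c = nth 0 r (index a (enum A)).
    apply/witt_of_isometry_class_image; rewrite dim_subvs; apply: adm.
    by rewrite mem_enum.
  pose c a := sval (cid (ex a)).
  have Fc : F c = r.
    rewrite -[RHS](map_nth_index 0 enumU size_r); apply: eq_map => a.
    exact: (svalP (cid (ex a))).
  exists c => //; rewrite /assignments /=.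
  rewrite -[RHS]sum_r -Fc big_map big_enum.
  exact: erefl.
apply: card_eq_trans (card_mem_seq (uniq_witt_solutions w_inj dims u)).
by rewrite -F_im card_eq_sym; apply: inj_card_eq => x y _ _; apply: F_inj.
Qed.
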